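(* For every integer $n \geq 2$, we have $\mathtt{BAIRE}(\mathbb{Z}^n) \subsetneq \mathtt{BaireSHIFT}(\mathbb{Z}^n)$.
   Context: Let $\Gamma$ be a finitely generated group. A locally checkable labeling (LCL) problem on $\Gamma$ is a triple $\Pi = (W, \Lambda, \mathcal{A})$ where $W \subseteq \Gamma$ is a finite set, $\Lambda$ is a finite set (of labels), and $\mathcal{A} \subseteq \Lambda^W$ is a family of maps $W \to \Lambda$. Given an action of $\Gamma$ on a set $X$, a solution to $\Pi$ on $X$ (or a $\Pi$-labeling of $X$) is a function $f \colon X \to \Lambda$ such that for all $x \in X$, the map $W \to \Lambda$, $w \mapsto f(w \cdot x)$, is in $\mathcal{A}$. An action of $\Gamma$ on $X$ is free if $\gamma \cdot x \neq x$ for all $x \in X$ and all non-identity $\gamma \in \Gamma$. The set $\Lambda$ is given the discrete topology. For a set $X$, the shift action of $\Gamma$ on $X^\Gamma$ is $(\gamma \cdot x)(\delta) = x(\delta\gamma)$ for $\gamma,\delta \in \Gamma$, $x \in X^\Gamma$. Its free part is $\mathcal{F}(X,\Gamma) = \{x \in X^\Gamma : \gamma \cdot x \neq x \text{ for all non-identity } \gamma \in \Gamma\}$. Write $2 = \{0,1\}$ with the discrete topology; $\mathcal{F}(2,\Gamma)$ carries the topology inherited from the product topology on $2^\Gamma$. Classes of LCL problems $\Pi = (W,\Lambda,\mathcal{A})$ on $\Gamma$: - $\Pi \in \mathtt{BAIRE}(\Gamma)$ iff every free Borel action of $\Gamma$ on a Polish space $X$ has a Baire-measurable $\Pi$-labeling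 $f \colon X \to \Lambda$. - $\Pi \in \mathtt{BaireSHIFT}(\Gamma)$ iff $\Pi$ has a Baire-measurable solution on $\mathcal{F}(2,\Gamma)$. *)

(* Defs.v *)
From HB Require Import structures.
From mathcomp Require Import all_boot all_order all_algebra finmap.
From mathcomp Require Import all_classical all_reals all_analysis.

Set Implicit Arguments.
Unset Strict Implicit.
Unset Printing Implicit Defensive.

Import Order.TTheory GRing.Theory Num.Theory.
Local Open Scope classical_set_scope.

Definition borel_set (X : topologicalType) : set (set X) := <<s @open X >>.

Definition nowhere_dense (X : topologicalType) (A : set X) : Prop :=
  interior (closure A) = set0.

Definition meager (X : topologicalType) (A : set X) : Prop :=
  exists2 F : (set X)^nat, (forall n, nowhere_dense (F n)) & A = \bigcup_n F n.

Definition baire_property (X : topologicalType) (A : set X) : Prop :=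
  exists2 U : set X, open U & meager (A `+` U).

Definition baire_measurable (X Y : topologicalType) (f : X -> Y) : Prop :=
  forall V : set Y, open V -> baire_property (f @^-1` V).

Definition separable (X : topologicalType) : Prop :=
  exists2 D : set X, countable D & dense D.

Section Metrizability.
Local Open Scope ring_scope.

Definition is_metric (R : realType) (X : Type) (d : X -> X -> R) : Prop :=
  [/\ forall x y, 0 <= d x y,
      forall x y, d x y = 0 <-> x = y,
      forall x y, d x y = d y x &
      forall x y z, d x z <= d x y + d y z].

Definition induces_topology (R : realType) (X : topologicalType)
    (d : X -> X -> R) : Prop :=
  forall (x : X) (A : set X),
    nbhs x A <-> exists2 e : R, 0 < e & [set y | d x y < e] `<=` A.

Definition cauchy_seq (R : realType) (X : Type) (d : X -> X -> R)
    (u : nat -> X) : Prop :=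
  forall e : R, 0 < e -> exists N : nat,
    forall m n : nat, (N <= m)%N -> (N <= n)%N -> d (u m) (u n) < e.

Definition completely_metrizable (R : realType) (X : topologicalType) : Prop :=
  exists d : X -> X -> R,
    [/\ is_metric d, induces_topology d &
        forall u : nat -> X, cauchy_seq d u -> exists l : X, u @ \oo --> l].

Definition polish (R : realType) (X : topologicalType) : Prop :=
  separable X /\ completely_metrizable R X.

End Metrizability.

Local Open Scope group_scope.

(** The library's actions are restricted to finite groups. *)
Record gaction (G : groupType) (X : Type) := GAction {
  gact :> G -> X -> X;
  gact1 : forall x, gact 1 x = x;
  gactM : forall g h x, gact (g * h) x = gact g (gact h x) }.

Definition free_action (G : groupType) (X : Type) (a : gaction G X) : Prop :=
  forall (g : G) (x : X), g <> 1 -> a g x <> x.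

(** The groups considered are countable and discrete, so Borelness of
    [G * X -> X] amounts to Borelness of each translation. *)
Definition borel_action (G : groupType) (X : topologicalType)
    (a : gaction G X) : Prop :=
  forall (g : G) (B : set X), borel_set B -> borel_set (a g @^-1` B).

Definition shift (G : groupType) (X : Type) (g : G) (x : G -> X) : G -> X :=
  fun d => x (d * g).

Lemma shift1 (G : groupType) (X : Type) (x : G -> X) : shift 1 x = x.
Proof. by apply/funext => d; rewrite /shift mulg1. Qed.

Lemma shiftM (G : groupType) (X : Type) (g h : G) (x : G -> X) :
  shift (g * h) x = shift g (shift h x).
Proof. by apply/funext => d; rewrite /shift mulgA. Qed.

Definition free_part (G : groupType) (X : topologicalType) :
    set {ptws G -> X} :=
  [set x | forall g : G, g <> 1 -> shift g x <> x].
Arguments free_part : clear implicits.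

Lemma free_part_shift (G : groupType) (X : topologicalType) (g : G)
    (x : {ptws G -> X}) :
  free_part G X x -> free_part G X (shift g x).
Proof.
move=> Fx h h1 e; apply: (Fx (g^-1 * h * g)).
  move=> c; apply: h1; apply: (mulIg g); apply: (mulgI g^-1).
  by rewrite mulgA c mul1g mulVg.
by rewrite -mulgA !shiftM e -shiftM mulVg shift1.
Qed.

(** Coerced to a type, [free_part G X] carries the topology induced by the
    product topology. *)
Definition shift_free (G : groupType) (X : topologicalType) (g : G)
    (x : free_part G X) : free_part G X :=
  exist _ (shift g (\val x) : {ptws G -> X})
    (mem_set (@free_part_shift G X g _ (set_mem (valP x)))).

Lemma shift_free1 (G : groupType) (X : topologicalType)
  (x : free_part G X) : shift_free 1 x = x.
Proof. by apply: val_inj; exact: shift1. Qed.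

Lemma shift_freeM (G : groupType) (X : topologicalType) (g h : G)
    (x : free_part G X) :
  shift_free (g * h) x = shift_free g (shift_free h x).
Proof. by apply: val_inj; exact: shiftM. Qed.

Definition free_shift_action (G : groupType) (X : topologicalType) :
    gaction G (free_part G X) :=
  GAction (@shift_free1 G X) (@shift_freeM G X).

Record LCL (G : groupType) := MkLCL {
  window : {fset G};
  label : finType;
  allowed : set (window -> label) }.

Definition is_solution (G : groupType) (P : LCL G) (X : Type)
    (a : gaction G X) (f : X -> label P) : Prop :=
  forall x : X, @allowed G P (fun w => f (a (\val w) x)).

Definition has_baire_solution (G : groupType) (P : LCL G)
    (X : topologicalType) (a : gaction G X) : Prop :=
  exists f : X -> discrete_topology (label P),
    baire_measurable f /\ is_solution (P := P) a f.

(** These classes are plain predicates because [LCL G] quantifies over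
    [finType], which is too large for [set (LCL G)]. The field [R] is only the
    codomain of the metrics in [polish]. *)
Definition BAIRE (R : realType) (G : groupType) (P : LCL G) : Prop :=
  forall (X : topologicalType) (a : gaction G X),
    polish R X -> free_action a -> borel_action a -> has_baire_solution P a.

Definition BaireSHIFT (G : groupType) (P : LCL G) : Prop :=
  has_baire_solution P (free_shift_action G bool).

(** The additive group of integer row vectors, in multiplicative notation. *)
Definition Zpow (n : nat) : groupType := GRing.to_multiplicative 'rV[int]_n.

(* Main.v *)
Require Import Defs.
From mathcomp Require Import all_boot all_order all_algebra finmap.
From mathcomp Require Import all_classical all_reals all_analysis.
From mathcomp Require Import zify ring.

(** The inclusion holds because the free part of [bool ^ Z^n], although not
    closed, is Polish: it is homeomorphic to a closed set of sequences, a point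
    being recorded together with, for each group element, the index of a place
    that witnesses that this element is not a period
    ([free_part_coordinates], [coord_polish]).

    For strictness, work in the plane spanned by the first two basis vectors
    and ask for a family of rectangles, pairwise either nested or disjoint and
    never touching, together with a two-colouring of the cells that alternates
    along rows and is constant along columns, except across the sides of the
    rectangles, where the colouring may jump freely. The labels only record
    where a side is crossed, and in which direction, so that the problem is
    local; the nested family is recovered from the height function that counts
    the rectangles around a cell, up to an additive constant. Nested families
    of finite sets that exhaust the orbits are known as toasts; the point is
    that the sets are required to be rectangles.

    On the shift the problem is solvable. Let a square be a ring of ones of
    radius [r] surrounded by zeros up to radius [3 * r + 2]. Any two squares,
    of whatever radii, are nested or disjoint, with a margin
    ([square_laminar]), and any finite pattern can be put inside one, so that
    the points covered by a square form a dense open set. Colouring a cell by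
    its column relative to the centre of the smallest square around it depends
    on finitely many bits of a covered point, hence is Baire measurable
    ([toast_BaireSHIFT]).

    The problem has no Baire-measurable solution for an action by translations
    of 3-adic integers in which each of the two basis vectors translates by a
    3-adic unit. By Baire category some orbit carries a labelling every pattern
    of which recurs with bounded gaps along every row and every column, and
    recurs at an odd horizontal distance. A long side of a rectangle would have
    to cross the sides of others, so all rectangles have bounded size; hence
    the height is bounded below along a row, and the cells of minimal height
    of that row are joined by paths around the rectangles, along which the
    colour is the parity of the column. This contradicts recurrence at an odd
    distance ([no_recurrent_valid]). *)

Set Implicit Arguments.
Unset Strict Implicit.
Unset Printing Implicit Defensive.

Import Order.TTheory GRing.Theory Num.Theory.
Local Open Scope ring_scope.

(** * Height functions of nested rectangles *)

(** Conditions satisfied, in each 2 by 2 block, by the number of rectangles around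
    a cell, when at most one rectangle separates the cells of the block. They
    allow the cells inside that rectangle to be two adjacent cells or a single
    one, but neither three cells nor two opposite ones. *)
Definition nested_height (H : int -> int -> int) : Prop :=
  forall i j : int,
  [/\ -1 <= H (i + 1) j - H i j <= 1,
      H (i + 1) j = H i j + 1 ->
        H i (j + 1) = H i j /\
        (H (i + 1) (j + 1) = H i j \/ H (i + 1) (j + 1) = H (i + 1) j),
      H i j = H (i + 1) j + 1 ->
        H (i + 1) (j + 1) = H (i + 1) j /\
        (H i (j + 1) = H (i + 1) j \/ H i (j + 1) = H i j) &
      H (i + 1) j = H i j ->
        H i (j + 1) = H (i + 1) (j + 1) \/
        (H i j <= H i (j + 1) /\ H i j <= H (i + 1) (j + 1))].

(** Every segment of length [L] of a row or of a column crosses some side. *)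
Definition crossed_within (L : nat) (H : int -> int -> int) : Prop :=
  forall i j : int,
    (exists2 a : nat, (a < L)%N & H (i + a%:Z + 1) j <> H (i + a%:Z) j) /\
    (exists2 a : nat, (a < L)%N & H i (j + a%:Z + 1) <> H i (j + a%:Z)).

Lemma mirror_nested H : nested_height H -> nested_height (fun i j => H (- i) j).
Proof.
move=> N i j; have [B0 B1 B2 B3] := N (- (i + 1)) j.
move: B0 B1 B2 B3; have -> : - (i + 1) + 1 = - i by lia.
move=> B0 B1 B2 B3; split; lia.
Qed.

Lemma mirror_crossed L H :
  crossed_within L H -> crossed_within L (fun i j => H (- i) j).
Proof.
move=> C i j; split; last by have [_] := C (- i) j.
have [[a aL ne] _] := C (- i - L%:Z) j.
have aL' : (a.+1 <= L)%N by [].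
exists (L - a.+1)%N; first by lia.
move=> e; apply: ne.
have -> : - i - L%:Z + a%:Z + 1 = - (i + (L - a.+1)%N%:Z) by lia.
have -> : - i - L%:Z + a%:Z = - (i + (L - a.+1)%N%:Z + 1) by lia.
by rewrite e.
Qed.

Section Rectangle.
Variables (H : int -> int -> int) (L : nat).
Hypotheses (nH : nested_height H) (cH : crossed_within L H).

(** A segment of height at least [k] extends upwards as soon as its left end
    does; otherwise it is topped over its whole length, and has constant
    height. *)
Lemma run_up k i j (w : nat) :
  (forall x : nat, (x <= w)%N -> k <= H (i + x%:Z) j) -> k <= H i (j + 1) ->
  forall x : nat, (x <= w)%N -> k <= H (i + x%:Z) (j + 1).
Proof.
move=> hk hi; elim=> [_|x IH xw]; first by rewrite addr0.
have := nH (i + x%:Z) j.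
have -> : i + x%:Z + 1 = i + x.+1%:Z by lia.
move: (IH (ltnW xw)) (hk x (ltnW xw)) (hk _ xw) => h1 h2 h3 [B0 B1 B2 B3].
lia.
Qed.

Lemma run_top k i j (w : nat) :
  (forall x : nat, (x <= w)%N -> k <= H (i + x%:Z) j) -> H i (j + 1) = k - 1 ->
  forall x : nat, (x <= w)%N ->
    H (i + x%:Z) (j + 1) = k - 1 /\ H (i + x%:Z) j = H i j.
Proof.
move=> hk hi; elim=> [_|x IH xw]; first by rewrite addr0.
have := nH (i + x%:Z) j.
have -> : i + x%:Z + 1 = i + x.+1%:Z by lia.
have [h0 h0'] := IH (ltnW xw).
move: (hk x (ltnW xw)) (hk _ xw) => h2 h3 [B0 B1 B2 B3].
lia.
Qed.

(** If the height rises to [k] from [(i - 1, j)] to [(i, j)], then the segment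
    of height at least [k] starting at [(i, j)] has at most [L] cells, and there
    is a path of cells of height [k - 1] around the part of the rectangle above
    row [j]: up the column [i - 1], along the row [j + t + 1] and down the
    column [i + w + 1]. The reason is that the left side must be crossed, hence
    end, above [(i, j)], and that the top side, which has constant height, is
    then crossed too. *)
Lemma entering_rectangle k i j : H (i - 1) j = k - 1 -> H i j = k ->
  exists w t : nat,
  [/\ (w < L)%N,
      forall x : nat, (x <= w)%N -> k <= H (i + x%:Z) j,
      forall y : nat, (y <= t.+1)%N ->
        H (i - 1) (j + y%:Z) = k - 1 /\ H (i + w.+1%:Z) (j + y%:Z) = k - 1 &
      forall x : nat, (x <= w)%N -> H (i + x%:Z) (j + t.+1%:Z) = k - 1].
Proof.
move=> h0 h1.
have ext : exists t : nat, H i (j + t%:Z + 1) != H i (j + t%:Z).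
  by have [_ [a _ /eqP]] := cH i j; exists a.
(* the row [j + t] contains the top side *)
pose t := ex_minn ext.
have [tne tmin] : H i (j + t%:Z + 1) <> H i (j + t%:Z) /\
    forall y, (y < t)%N -> H i (j + y%:Z + 1) = H i (j + y%:Z).
  rewrite /t; case: ex_minnP => m /eqP mP min; split => // y ym.
  by apply/eqP; apply: contraTT ym => /min; rewrite -leqNgt.
have side y : (y <= t)%N -> H (i - 1) (j + y%:Z) = k - 1 /\ H i (j + y%:Z) = k.
  elim: y => [_|y IH yt]; first by rewrite addr0.
  have [g0 g1] := IH (ltnW yt); have g2 := tmin _ yt.
  have := nH (i - 1) (j + y%:Z).
  have -> : i - 1 + 1 = i by lia.
  have -> : j + y.+1%:Z = j + y%:Z + 1 by lia.
  by rewrite g0 g1 g2 => -[_ B1 _ _]; lia.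
have [top0 top1] : H (i - 1) (j + t.+1%:Z) = k - 1 /\ H i (j + t.+1%:Z) = k - 1.
  have [g0 g1] := side _ (leqnn t).
  have := nH (i - 1) (j + t%:Z).
  have -> : i - 1 + 1 = i by lia.
  have -> : j + t.+1%:Z = j + t%:Z + 1 by lia.
  by move: tne; rewrite g0 g1 => tne -[_ B1 _ _]; lia.
have rows w y : (forall x : nat, (x <= w)%N -> k <= H (i + x%:Z) j) ->
    (y <= t)%N -> forall x : nat, (x <= w)%N -> k <= H (i + x%:Z) (j + y%:Z).
  move=> hw; elim: y => [_ x|y IH yt]; first by rewrite addr0; exact: hw.
  have -> : j + y.+1%:Z = j + y%:Z + 1 by lia.
  apply: run_up; first exact: IH (ltnW yt).
  by rewrite tmin //; have [_ ->] := side _ (ltnW yt).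
have short w : (forall x : nat, (x <= w)%N -> k <= H (i + x%:Z) j) -> (w < L)%N.
  move=> hw; have [[a aL ne] _] := cH i (j + t%:Z).
  apply: leq_ltn_trans aL; rewrite leqNgt; apply/negP => aw; apply: ne.
  have tp x (xw : (x <= w)%N) : H (i + x%:Z) (j + t%:Z) = H i (j + t%:Z).
    apply: (proj2 (@run_top k i (j + t%:Z) w _ _ x xw)).
      exact: rows.
    by rewrite -top1; congr (H _ _); lia.
  have -> : i + a%:Z + 1 = i + a.+1%:Z by lia.
  by rewrite tp // tp // ltnW.
have exw : exists w : nat, H (i + w.+1%:Z) j < k.
  have [//|no] := boolP [exists w : 'I_L, H (i + w.+1%:Z) j < k].
    by case/existsP => w ?; exists w.
  move: no; rewrite negb_exists => /forallP no.
  have : (L < L)%N; last by rewrite ltnn.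
  apply: short => -[_|x xL]; first by rewrite addr0 h1.
  by have := no (Ordinal xL); rewrite -leNgt.
pose w := ex_minn exw.
have [wlt wmin] : H (i + w.+1%:Z) j < k /\
    forall x : nat, (x <= w)%N -> k <= H (i + x%:Z) j.
  rewrite /w; case: ex_minnP => m mP min; split => // -[_|x xm].
    by rewrite addr0 h1.
  by rewrite leNgt; apply/negP => /min; rewrite leqNgt xm.
exists w, t; split => //; first exact: short.
  have out y : (y <= t.+1)%N -> H (i + w.+1%:Z) (j + y%:Z) = k - 1.
    elim: y => [_|y IH yt].
      have := nH (i + w%:Z) j; have := wmin _ (leqnn w).
      rewrite addr0; have -> : i + w%:Z + 1 = i + w.+1%:Z by lia.
      by move=> ? [? _ _ _]; lia.
    have := nH (i + w%:Z) (j + y%:Z); have := rows w y wmin yt w (leqnn w).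
    have -> : i + w%:Z + 1 = i + w.+1%:Z by lia.
    have -> : j + y.+1%:Z = j + y%:Z + 1 by lia.
    by rewrite IH ?(ltnW yt) // => ? [? _ B2 _]; lia.
  move=> y yt; split; last exact: out.
  move: yt; rewrite leq_eqVlt => /orP[/eqP -> //|yt].
  by have [] := side y yt.
move=> x xw.
have -> : j + t.+1%:Z = j + t%:Z + 1 by lia.
apply: (proj1 (@run_top k i (j + t%:Z) w _ _ x xw)); first exact: rows.
by rewrite -top1; congr (H _ _); lia.
Qed.

End Rectangle.

(** A descent by more than [L] to the left takes more than [L] steps, and ends
    on the left side of a rectangle that would be longer than [L]. *)
Lemma bounded_below_left H L : nested_height H -> crossed_within L H ->
  forall i j (m : nat), H i j - L%:Z <= H (i - m%:Z) j.
Proof.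
move=> nH cH i j m; rewrite leNgt; apply/negP => lt.
have exm : exists m : nat, H (i - m%:Z) j < H i j - L%:Z by exists m.
case: (ex_minnP exm) => {lt exm}m lt min.
have ge x : (x < m)%N -> H i j - L%:Z <= H (i - x%:Z) j.
  by move=> xm; rewrite leNgt; apply/negP => /min; rewrite leqNgt xm.
have slow x : H i j - x%:Z <= H (i - x%:Z) j.
  elim: x => [|x IH]; first by rewrite !subr0.
  have [] := nH (i - x.+1%:Z) j.
  have -> : i - x.+1%:Z + 1 = i - x%:Z by lia.
  by lia.
have Lm : (L < m)%N by have := slow m; lia.
have [m' em] : exists m', m = m'.+1 by exists m.-1; lia.
have hm' : H (i - m'%:Z) j = H i j - L%:Z /\ H (i - m'%:Z - 1) j = H i j - L%:Z - 1.
  have := ge m'; have [] := nH (i - m%:Z) j; move: lt.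
  have -> : i - m%:Z + 1 = i - m'%:Z by lia.
  have -> : i - m%:Z = i - m'%:Z - 1 by lia.
  by lia.
have [w [t [wL _ out _]]] := entering_rectangle nH cH (proj2 hm') (proj1 hm').
have [_] := out 0%N isT; rewrite addr0.
have [le|lt'] := leqP w.+1 m'.
  have /ge : (m' - w.+1 < m)%N by lia.
  have -> : i - (m' - w.+1)%N%:Z = i - m'%:Z + w.+1%:Z by lia.
  by move=> ge_k eq_k; move: ge_k; rewrite eq_k; clear; lia.
lia.
Qed.

Lemma bounded_below_row H L : nested_height H -> crossed_within L H ->
  forall i i' j, H i j - L%:Z <= H i' j.
Proof.
move=> nH cH i i' j; have [le|lt] := leP i' i.
  by have := bounded_below_left nH cH i j `|i - i'|%N;
     have -> : i - `|(i - i')%R|%N%:Z = i' by lia.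
have := bounded_below_left (mirror_nested nH) (mirror_crossed cH) (- i) j
  `|i' - i|%N.
rewrite /=; have -> : - (- i - `|(i' - i)%R|%N%:Z) = i' by lia.
by rewrite opprK.
Qed.

Lemma row_minimum H L : nested_height H -> crossed_within L H ->
  forall j, exists i, forall i', H i j <= H i' j.
Proof.
move=> nH cH j; have lb := bounded_below_row nH cH 0 ^~ j.
have ex : exists m : nat, `[< exists i, H i j = H 0 j - L%:Z + m%:Z >].
  by exists L; apply/asboolP; exists 0; lia.
case: (ex_minnP ex) => m /asboolP[i ei] min; exists i => i'.
have /min : `[< exists i0, H i0 j = H 0 j - L%:Z +
    (absz (H i' j - (H 0 j - L%:Z))%R)%:Z >].
  by apply/asboolP; exists i'; have := lb i'; lia.
by have := lb i'; lia.
Qed.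

Lemma exists_primitive (d : int -> int) :
  exists S : int -> int, forall i, S (i + 1) = S i + d i.
Proof.
exists (fun i => match i with
  | Posz m => \sum_(t < m) d t%:Z
  | Negz m => - \sum_(t < m.+1) d (- t.+1%:Z) end).
case=> [m|[|m]].
- have -> : Posz m + 1 = Posz m.+1 by lia.
  by rewrite big_ord_recr.
- have -> : Negz 0 + 1 = 0%N by lia.
  by rewrite big_ord0 big_ord1 NegzE addNr.
- have -> : Negz m.+1 + 1 = Negz m by lia.
  by rewrite [in RHS]big_ord_recr /= NegzE opprD addrNK.
Qed.

(** * Labels, local rules and recurrence *)

(** A label consists of five bits: whether one enters, resp. leaves, a rectangle
    when moving to the right; the same when moving up; and a colour. *)
Definition cell_label : Type := (bool * bool * bool * bool * bool)%type.

(** The variation of the height when moving to the right, and when moving up. *)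
Definition dE (l : cell_label) : int := let '(p, q, _, _, _) := l in p%:Z - q%:Z.
Definition dN (l : cell_label) : int := let '(_, _, p, q, _) := l in p%:Z - q%:Z.
Definition colour_bit (l : cell_label) : bool := let '(_, _, _, _, c) := l in c.

(** The rules involve the labels [l], [l1] and [l2] of a cell, of its right
    neighbour and of its upper neighbour. The first four conditions say that
    the height is well defined on the 2 by 2 block whose lower left corner is
    that cell, and satisfies [nested_height] there; the last one forbids two
    consecutive vertical sides. *)
Definition depth_rule (l l1 l2 : cell_label) : bool :=
  [&& dE l + dN l1 == dN l + dE l2,
      (dE l == 1) ==> (dN l == 0) && (dN l1 != 1),
      (dE l == -1) ==> (dN l1 == 0) && (dN l != 1),
      (dE l == 0) ==> (dN l == dN l1) || (0 <= dN l) && (0 <= dN l1) &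
      (dE l != 0) ==> (dE l1 == 0)].

(** Unless a side is crossed, the colour alternates along rows and is constant
    along columns. *)
Definition phase_rule (l l1 l2 : cell_label) : bool :=
  ((dE l == 0) ==> (colour_bit l1 != colour_bit l)) &&
  ((dN l == 0) ==> (colour_bit l2 == colour_bit l)).

Definition rule (l l1 l2 : cell_label) : bool :=
  depth_rule l l1 l2 && phase_rule l l1 l2.

Lemma ruleP l l1 l2 : rule l l1 l2 ->
  [/\ dE l + dN l1 = dN l + dE l2,
      dE l = 1 -> dN l = 0 /\ dN l1 <> 1,
      dE l = -1 -> dN l1 = 0 /\ dN l <> 1,
      dE l = 0 -> dN l = dN l1 \/ (0 <= dN l /\ 0 <= dN l1) &
      dE l <> 0 -> dE l1 = 0] /\
  ((dE l = 0 -> colour_bit l1 = ~~ colour_bit l) /\ (dN l = 0 -> colour_bit l2 = colour_bit l)).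
Proof.
case/andP=> /and5P[/eqP r0 r1 r2 r3 r4] /andP[p1 p2].
split; first by split => //; move: r1 r2 r3 r4; lia.
split=> [e|e]; move: p1 p2; rewrite e eqxx /= => p1 p2; last exact/eqP.
by move: p1; case: (colour_bit l); case: (colour_bit l1).
Qed.

Lemma dE_range l : -1 <= dE l <= 1.
Proof. by case: l => [[[[[] []] ?] ?] ?]. Qed.

Lemma dN_range l : -1 <= dN l <= 1.
Proof. by case: l => [[[[? ?] []] []] ?]. Qed.

Definition valid (z : int -> int -> cell_label) : Prop :=
  forall i j, rule (z i j) (z (i + 1) j) (z i (j + 1)).

(** Each label recurs in every row and every column with bounded gaps, and each
    horizontal word recurs at an odd distance to the right. *)
Definition recurrent (z : int -> int -> cell_label) : Prop :=
  forall (i j : int) (M : nat), exists N : nat, [/\ odd N,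
    forall i' j', exists2 a : nat, (a < N)%N & z (i' + a%:Z) j' = z i j,
    forall i' j', exists2 a : nat, (a < N)%N & z i' (j' + a%:Z) = z i j &
    forall u : nat, (u <= M)%N -> z (i + N%:Z + u%:Z) j = z (i + u%:Z) j].

(** [H] counts rectangles up to a constant: its increments are read off the
    labels. *)
Definition height (z : int -> int -> cell_label) (H : int -> int -> int) : Prop :=
  forall i j, H (i + 1) j = H i j + dE (z i j) /\
              H i (j + 1) = H i j + dN (z i j).

Lemma int_rect1 (P : int -> Prop) :
  P 0 -> (forall i, P i <-> P (i + 1)) -> forall i, P i.
Proof.
move=> P0 PS; elim/int_rect => // m.
  by move=> /PS; have -> : m%:Z + 1 = m.+1%:Z by lia.
move=> Pm; apply/PS; by have -> : - m.+1%:Z + 1 = - m%:Z by lia.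
Qed.

Lemma height_exists z : valid z ->
  exists H : int -> int -> int, height z H.
Proof.
move=> vz; have [S hS] := exists_primitive (fun i => dE (z i 0)).
have /choice[T hT] i := exists_primitive (fun j => dN (z i j)).
exists (fun i j => S i + (T i j - T i 0)) => i j; split; last first.
  by rewrite hT; ring.
elim/int_rect1: j => [|j]; first by rewrite hS; ring.
have [[e _ _ _ _] _] := ruleP (vz i j).
rewrite !hT /=.
move: (dE _) (dE (z i (j + 1))) (dN _) (dN (z (i + 1) j)) e => a a' b b' e.
by split=> h; lia.
Qed.

Lemma valid_nested z H : valid z -> height z H ->
  nested_height H.
Proof.
move=> vz hH i j; have [[e R1 R2 R3 _] _] := ruleP (vz i j).
have [e1 e2] := hH i j; have [_ e3] := hH (i + 1) j.
have := dE_range (z i j); have := dN_range (z i j).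
have := dN_range (z (i + 1) j).
rewrite e3 e1 e2.
move: (dE _) (dN _) (dN (z (i + 1) j)) (H i j) R1 R2 R3 => a b b' h.
by move=> R1 R2 R3; split; lia.
Qed.

Section NoRecurrent.
Variable z : int -> int -> cell_label.
Hypotheses (vz : valid z) (rz : recurrent z).

(** Otherwise the whole row alternates, against recurrence at an odd distance. *)
Lemma some_dE : exists i j, dE (z i j) <> 0.
Proof.
apply: contrapT => no.
have all0 i j : dE (z i j) = 0.
  by apply: contrapT => ne; apply: no; exists i, j.
have flip (m : nat) : colour_bit (z m%:Z 0) = colour_bit (z 0 0) (+) odd m.
  elim: m => [|m IH]; first by rewrite addbF.
  have [_ [/(_ (all0 _ _)) + _]] := ruleP (vz m%:Z 0).
  have -> : m%:Z + 1 = m.+1%:Z by lia.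
  by move=> ->; rewrite IH /= addbN.
have [N [oN _ _ /(_ 0%N isT)]] := rz 0 0 0.
by rewrite add0r !addr0 => e; have := flip N; rewrite e oN; case: colour_bit.
Qed.

(** Otherwise a vertical side would be an infinite line, hence by recurrence
    would occur in every column, while two sides are never adjacent. *)
Lemma some_dN : exists i j, dN (z i j) <> 0.
Proof.
apply: contrapT => no.
have all0 i j : dN (z i j) = 0.
  by apply: contrapT => ne; apply: no; exists i, j.
have col i j (m : nat) : dE (z i (j + m%:Z)) = dE (z i j).
  elim: m => [|m <-]; first by rewrite addr0.
  have [[+ _ _ _ _] _] := ruleP (vz i (j + m%:Z)).
  have -> : j + m%:Z + 1 = j + m.+1%:Z by lia.
  by rewrite !all0 => e; lia.
have [i [j ne]] := some_dE.
have [N [_ _ up _]] := rz i j 0.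
have eE i' j' : dE (z i' j') = dE (z i j).
  by have [a _ <-] := up i' j'; rewrite col.
by have [[_ _ _ _ /(_ ne) e] _] := ruleP (vz i j); apply: ne; rewrite -(eE (i + 1) j).
Qed.

Lemma crossed_height H : height z H ->
  exists L, crossed_within L H.
Proof.
move=> hH.
have [i1 [j1 ne1]] := some_dE; have [i2 [j2 ne2]] := some_dN.
have [N1 [_ h1 _ _]] := rz i1 j1 0; have [N2 [_ _ v2 _]] := rz i2 j2 0.
exists (maxn N1 N2) => i j; split.
  have [a aN e] := h1 i j; exists a; first by rewrite leq_max aN.
  by have [-> _] := hH (i + a%:Z) j; rewrite e; move: ne1; clear; lia.
have [a aN e] := v2 i j; exists a; first by rewrite leq_max aN orbT.
by have [_ ->] := hH i (j + a%:Z); rewrite e; move: ne2; clear; lia.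
Qed.

(** The colour relative to the parity of the column; it does not change along a
    path that crosses no side. *)
Definition column_phase (i j : int) : bool := colour_bit (z i j) (+) odd (absz i).

Lemma odd_absz_succ (i : int) : odd (absz (i + 1)%R) = ~~ odd (absz i).
Proof. by lia. Qed.

Lemma column_phase_right H : height z H ->
  forall i j, H (i + 1) j = H i j -> column_phase (i + 1) j = column_phase i j.
Proof.
move=> hH i j; have [-> _] := hH i j => e.
rewrite /column_phase odd_absz_succ; have [_ [->]] := ruleP (vz i j).
  by rewrite addNb addbN negbK.
by move: e; clear; lia.
Qed.

Lemma column_phase_up H : height z H ->
  forall i j, H i (j + 1) = H i j -> column_phase i (j + 1) = column_phase i j.
Proof.
move=> hH i j; have [_ ->] := hH i j => e.
rewrite /column_phase; have [_ [_ ->]] := ruleP (vz i j) => //.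
by move: e; clear; lia.
Qed.

(** Along a row, the cells of minimal height all have the same value of
    [column_phase], and they recur at an odd distance with the same colour. *)
Lemma no_recurrent_valid : False.
Proof.
have [H hH] := height_exists vz; have nH := valid_nested vz hH.
have [L cH] := crossed_height hH.
have pR := column_phase_right hH; have pU := column_phase_up hH.
have pU' i j (t : nat) : (forall y : nat, (y <= t)%N -> H i (j + y%:Z) = H i j) ->
    column_phase i (j + t%:Z) = column_phase i j.
  elim: t => [|t IH] ht; first by rewrite addr0.
  rewrite -IH => [|y yt]; last exact/ht/leqW.
  have e1 : j + t.+1%:Z = j + t%:Z + 1 by lia.
  rewrite e1; apply: pU; rewrite (ht t) //.
  by rewrite -e1 ht.
have pR' i j (t : nat) : (forall y : nat, (y <= t)%N -> H (i + y%:Z) j = H i j) ->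
    column_phase (i + t%:Z) j = column_phase i j.
  elim: t => [|t IH] ht; first by rewrite addr0.
  rewrite -IH => [|y yt]; last exact/ht/leqW.
  have e1 : i + t.+1%:Z = i + t%:Z + 1 by lia.
  rewrite e1; apply: pR; rewrite (ht t) //.
  by rewrite -e1 ht.
have [v vmin] := row_minimum nH cH 0.
(* a rectangle met on row 0 is bypassed through the row above its top side *)
have around i k : H i 0 = k - 1 -> H (i + 1) 0 = k -> exists w : nat,
    [/\ (w < L)%N, forall x : nat, (x <= w)%N -> k <= H (i + 1 + x%:Z) 0,
        H (i + w.+2%:Z) 0 = k - 1 & column_phase (i + w.+2%:Z) 0 = column_phase i 0].
  move=> h0 h1; have h0' : H (i + 1 - 1) 0 = k - 1 by rewrite addrK.
  have [w [t [wL ge side top]]] := entering_rectangle nH cH h0' h1.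
  have ew : i + 1 + w.+1%:Z = i + w.+2%:Z by lia.
  rewrite ew addrK in side.
  exists w; split => //; first by have [_] := side 0%N isT; rewrite addr0.
  have <- : column_phase i (0 + t.+1%:Z) = column_phase i 0.
    by apply: pU' => y yt; rewrite h0; have [] := side y yt.
  have <- : column_phase (i + w.+2%:Z) (0 + t.+1%:Z) = column_phase (i + w.+2%:Z) 0.
    apply: pU' => y yt; have [_ ->] := side y yt.
    by have [_] := side 0%N isT; rewrite addr0.
  have [l0 r0] := side _ (leqnn t.+1).
  apply: pR' => -[|y]; first by rewrite addr0.
  rewrite leq_eqVlt => /orP[/eqP [->]|]; first by rewrite l0 r0.
  rewrite !ltnS => yw; rewrite l0 -(top y yw); congr (H _ _).
  by clear; lia.
set m := H v 0 in vmin.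
have step x : H x 0 = m -> H (x + 1) 0 <> m -> H (x + 1) 0 = m + 1.
  by move=> e ne; have := vmin (x + 1); have [+ _ _ _] := nH x 0; clear -e ne; lia.
have sea : forall d : nat, H (v + d%:Z) 0 = m ->
    column_phase (v + d%:Z) 0 = column_phase v 0.
  suff gen : forall n (x : int), H x 0 = m -> forall d : nat, (d <= n)%N ->
      H (x + d%:Z) 0 = m -> column_phase (x + d%:Z) 0 = column_phase x 0.
    by move=> d; exact: gen (leqnn d).
  elim=> [|n IH] x hx d; first by rewrite leqn0 => /eqP ->; rewrite addr0.
  case: d => [|d] dn hd; first by rewrite addr0.
  have [e|/eqP/(step _ hx) e] := eqVneq (H (x + 1) 0) m.
    rewrite -(pR x 0) ?e //.
    have xd : x + d.+1%:Z = x + 1 + d%:Z by lia.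
    by move: hd; rewrite xd => hd; exact: IH hd.
  have [|w [_ ge out <-]] := around x (m + 1) _ e; first by rewrite addrK.
  have dw : (w.+2 <= d.+1)%N.
    rewrite ltnS ltnNge; apply/negP => /ge.
    have -> : x + 1 + d%:Z = x + d.+1%:Z by lia.
    by rewrite hd; clear; lia.
  have xd : x + d.+1%:Z = x + w.+2%:Z + (d.+1 - w.+2)%N%:Z by lia.
  move: hd; rewrite xd => hd; apply: IH hd; first by rewrite out addrK.
  by move: dn; clear; lia.
have [N [oN _ _ pat]] := rz v 0 L.
(* The height at [v + N] is again minimal: otherwise [v + N] would lie in a
   rectangle, and the minimal height would be reached at most [L] cells
   further, whereas the heights near [v + N] vary as those near [v]. *)
have dH (t : nat) : (t <= L)%N ->
    H (v + N%:Z + t%:Z) 0 - H (v + N%:Z) 0 = H (v + t%:Z) 0 - m.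
  elim: t => [_|t IH tL]; first by rewrite !addr0 /m !subrr.
  have e1 : v + N%:Z + t.+1%:Z = v + N%:Z + t%:Z + 1 by lia.
  have e2 : v + t.+1%:Z = v + t%:Z + 1 by lia.
  have [h1 _] := hH (v + N%:Z + t%:Z) 0; have [h2 _] := hH (v + t%:Z) 0.
  by rewrite e1 e2 h1 h2 (pat t (ltnW tL)) addrAC (IH (ltnW tL)) addrAC.
have hN : H (v + N%:Z) 0 = m.
  apply: contrapT => ne.
  have [n0 [n0N hn0 last]] : exists n0 : nat, [/\ (n0 < N)%N, H (v + n0%:Z) 0 = m &
      forall x : nat, (n0 < x <= N)%N -> H (v + x%:Z) 0 <> m].
    have : exists n0 : nat, (n0 <= N)%N && (H (v + n0%:Z) 0 == m).
      by exists 0%N; rewrite addr0 eqxx.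
    move=> /(@ex_maxnP _ N)[|n0 /andP[n0N /eqP hn0] max].
      by move=> i /andP[].
    exists n0; split => //.
      by rewrite ltn_neqAle n0N andbT; apply/eqP => e; apply: ne; rewrite -e.
    move=> x /andP[n0x xN] /eqP hx; have := max x; rewrite xN hx => /(_ isT).
    by rewrite leqNgt n0x.
  have en0 : v + n0.+1%:Z = v + n0%:Z + 1 by lia.
  have /(step _ hn0) e : H (v + n0%:Z + 1) 0 <> m.
    by rewrite -en0; apply: last; rewrite ltnSn.
  have [|w [wL ge out _]] := around (v + n0%:Z) (m + 1) _ e; first by rewrite addrK.
  rewrite addrK in out.
  have Nw : (N < n0 + w.+2)%N.
    rewrite ltnNge; apply/negP => le; apply: (last (n0 + w.+2)%N).
      by rewrite le andbT; lia.
    by rewrite -[RHS]out; congr (H _ _); lia.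
  have := dH (n0 + w.+2 - N)%N _; have -> : v + N%:Z + (n0 + w.+2 - N)%N%:Z =
    v + n0%:Z + w.+2%:Z by lia.
  rewrite out => /(_ ltac:(lia)).
  have := vmin (v + (n0 + w.+2 - N)%N%:Z); have := vmin (v + N%:Z).
  by move: ne; clear; lia.
have := sea N hN; rewrite /column_phase.
have := pat 0%N isT; rewrite !addr0 => ->.
have -> : odd (absz (v + N%:Z)%R) = ~~ odd (absz v) by move: oN; clear; lia.
by case: colour_bit; case: odd.
Qed.

End NoRecurrent.

(** * Squares in a planar configuration of bits *)

(** The box of centre [(c, d)] and radius [r]. *)
Definition box (c d : int) (r : nat) (i j : int) : bool :=
  [&& c - r%:Z <= i, i <= c + r%:Z, d - r%:Z <= j & j <= d + r%:Z].

(** A ring of ones of radius exactly [r] with zeros from there up to radius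
    [3 * r + 2]; the bits strictly inside the ring are arbitrary. *)
Definition square (y : int -> int -> bool) (c d : int) (r : nat) : Prop :=
  (0 < r)%N /\ forall i j, box c d (3 * r + 2)%N i j -> ~~ box c d r.-1 i j ->
    y i j = box c d r i j.

Lemma square_swap y c d r : square y c d r -> square (fun i j => y j i) d c r.
Proof.
have swap e i j : box d c e i j = box c d e j i by rewrite /box; lia.
by case=> r0 sq; split => // i j; rewrite !swap; exact: sq.
Qed.

Lemma square_mirror y c d r :
  square y c d r -> square (fun i j => y (- i) j) (- c) d r.
Proof.
have mir e i j : box (- c) d e i j = box c d e (- i) j by rewrite /box; lia.
by case=> r0 sq; split => // i j; rewrite !mir; exact: sq.
Qed.

(** The case where the second centre lies to the right of the first one, within
    the diagonals. If the square of radius [r'] stuck out of the other one, the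
    middle of its right side would be a one lying in the zeros of the other;
    this is where the outer radius [3 * r + 2] is needed. If its right side were
    on, or just inside, the right side of the other, a zero around it would lie
    on the ring of ones of the other. *)
Lemma square_nested_right y c d r c' d' r' :
  square y c d r -> square y c' d' r' -> (r' <= r)%N ->
  0 <= c' - c -> c' - c <= r%:Z + r'%:Z + 2 ->
  - (c' - c) <= d' - d <= c' - c ->
  (c' = c /\ d' = d /\ r' = r) \/ c' - c + r'%:Z + 2 <= r%:Z.
Proof.
move=> [r0 sq] [r0' sq'] rr D0 Dr e.
have le : c' - c + r'%:Z <= r%:Z.
  have h' := sq' (c' + r'%:Z) d'; have h := sq (c' + r'%:Z) d'.
  by move: h h'; rewrite /box; lia.
have ne1 : c' - c + r'%:Z <> r%:Z - 1.
  have h' := sq' (c' + r'%:Z + 1) d'; have h := sq (c' + r'%:Z + 1) d'.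
  by move: h h'; rewrite /box; lia.
have [eD|neD] := eqVneq (c' - c + r'%:Z) r%:Z; last by right; lia.
have [D00|D1] := eqVneq c' c; first by left; lia.
have [e0|e0] := lerP (d' - d) 0.
  have h' := sq' (c' + r'%:Z) (d' + r'%:Z + 1).
  have h := sq (c' + r'%:Z) (d' + r'%:Z + 1).
  by move: h h'; rewrite /box; lia.
have h' := sq' (c' + r'%:Z) (d' - r'%:Z - 1).
have h := sq (c' + r'%:Z) (d' - r'%:Z - 1).
by move: h h'; rewrite /box; lia.
Qed.

(** The relative positions of two squares, with their margins. *)
Variant laminar_spec (c d : int) (r : nat) (c' d' : int) (r' : nat) : Prop :=
  | LaminarSame of c' = c & d' = d & r' = r
  | LaminarNested of c - r%:Z + 2 <= c' - r'%:Z & c' + r'%:Z + 2 <= c + r%:Z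
                   & d - r%:Z + 2 <= d' - r'%:Z & d' + r'%:Z + 2 <= d + r%:Z
  | LaminarFar of
      (c + r%:Z + 2 < c' - r'%:Z \/ c' + r'%:Z + 2 < c - r%:Z) \/
      (d + r%:Z + 2 < d' - r'%:Z \/ d' + r'%:Z + 2 < d - r%:Z).

Lemma square_laminar y c d r c' d' r' :
  square y c d r -> square y c' d' r' -> (r' <= r)%N ->
  laminar_spec c d r c' d' r'.
Proof.
move=> sq sq' rr.
have [far|near] := pselect
    ((c + r%:Z + 2 < c' - r'%:Z \/ c' + r'%:Z + 2 < c - r%:Z) \/
     (d + r%:Z + 2 < d' - r'%:Z \/ d' + r'%:Z + 2 < d - r%:Z)).
  exact: LaminarFar far.
suff [[e1 [e2 e3]]|[n1 [n2 [n3 n4]]]] : (c' = c /\ d' = d /\ r' = r) \/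
    (c - r%:Z + 2 <= c' - r'%:Z /\ c' + r'%:Z + 2 <= c + r%:Z /\
     d - r%:Z + 2 <= d' - r'%:Z /\ d' + r'%:Z + 2 <= d + r%:Z).
- exact: LaminarSame.
- exact: LaminarNested.
have [cd|dc] := leP (`|d' - d|) (`|c' - c|).
  have [c0|c0] := lerP 0 (c' - c).
    by have := square_nested_right sq sq' rr; lia.
  by have := square_nested_right (square_mirror sq) (square_mirror sq') rr; lia.
have [d0|d0] := lerP 0 (d' - d).
  by have := square_nested_right (square_swap sq) (square_swap sq') rr; lia.
have := square_nested_right (square_mirror (square_swap sq))
  (square_mirror (square_swap sq')) rr.
by lia.
Qed.

(** Some square contains [(i', j')] and not [(i, j)]. *)
Definition enters (y : int -> int -> bool) (i j i' j' : int) : Prop :=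
  exists c d r, [/\ square y c d r, ~~ box c d r i j & box c d r i' j'].

(** At most one square separates cells of a 3 by 3 patch, because of the margins.
    Its indicator function is a product of indicators of intervals of length at
    least 3; if there is none, the constant function serves. *)
Lemma enters_patch y i j : exists hx hy : int -> bool,
  [/\ hx i -> hx (i + 2) -> hx (i + 1), hx (i + 1) -> hx i || hx (i + 2) &
  forall a b a' b' : int,
    i <= a <= i + 2 -> i <= a' <= i + 2 -> j <= b <= j + 2 -> j <= b' <= j + 2 ->
    `[< enters y a b a' b' >] = ~~ (hx a && hy b) && (hx a' && hy b')].
Proof.
have [[a [b [a' [b' [ra ra' [rb rb' [c [d [r [sq out inn]]]]]]]]]]|no] := pselect
    (exists a b a' b' : int, [/\ i <= a <= i + 2, i <= a' <= i + 2 &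
      [/\ j <= b <= j + 2, j <= b' <= j + 2 & enters y a b a' b']]).
  exists (fun i => (c - r%:Z <= i) && (i <= c + r%:Z)),
         (fun j => (d - r%:Z <= j) && (j <= d + r%:Z)).
  have [r0 _] := sq; split; [lia|lia|] => a1 b1 a2 b2 ra1 ra2 rb1 rb2.
  apply/asboolP/idP => [[c' [d' [r' [sq' out' inn']]]]|]; last first.
    move=> /andP[n1 n2]; exists c, d, r; split => //.
      by rewrite /box; lia.
    by rewrite /box; lia.
  have [rr|rr] := leqP r' r.
    have [???|????|far] := square_laminar sq sq' rr;
      by rewrite /box in out inn out' inn'; lia.
  have [???|????|far] := square_laminar sq' sq (ltnW rr);
    by rewrite /box in out inn out' inn'; lia.
exists xpredT, xpredT; split => // a b a' b' ra ra' rb rb'.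
apply/asboolP => en; apply: no.
by exists a, b, a', b'.
Qed.

(** A square of least radius among those that contain [(i, j)]. *)
Definition smallest (y : int -> int -> bool) (i j c d : int) (r : nat) : Prop :=
  [/\ square y c d r, box c d r i j &
      forall c' d' r', square y c' d' r' -> box c' d' r' i j -> (r <= r')%N].

Definition covered (y : int -> int -> bool) (i j : int) : Prop :=
  exists c d r, square y c d r /\ box c d r i j.

Lemma smallest_exists y i j : covered y i j -> exists c d r, smallest y i j c d r.
Proof.
case=> c [d [r sq]].
have ex : exists r, `[< exists c d, square y c d r /\ box c d r i j >].
  by exists r; apply/asboolP; exists c, d.
case: (ex_minnP ex) => m /asboolP[c' [d' [sq' b']]] min.
exists c', d', m; split => // c2 d2 r2 sq2 b2.
by apply: min; apply/asboolP; exists c2, d2.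
Qed.

Lemma smallest_same_column y i j c d r c' d' r' :
  smallest y i j c d r -> smallest y i j c' d' r' -> c = c'.
Proof.
move=> [sq b min] [sq' b' min'].
have e : r' = r by apply/eqP; rewrite eqn_leq (min _ _ _ sq' b') (min' _ _ _ sq b).
have [->|????|far] // := square_laminar sq sq' (eq_leq e).
  by rewrite e in sq' b' *; lia.
by rewrite /box in b b'; lia.
Qed.

(** The colour of [(i, j)]: the parity of its column relative to the centre of
    the smallest square around it, and [p] if there is none. *)
Definition colour (y : int -> int -> bool) (i j : int) (p : bool) : bool :=
  if pselect (covered y i j)
  then `[< exists c d r, smallest y i j c d r /\ odd (absz (i - c)) >] else p.

Lemma colour_smallest y i j c d r p :
  smallest y i j c d r -> colour y i j p = odd (absz (i - c)).
Proof.
move=> sm; rewrite /colour; case: pselect => [cov|ncov] /=; last first.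
  by case: ncov; have [sq b _] := sm; exists c, d, r.
apply/asboolP/idP => [[c' [d' [r' [sm' oc]]]]|oc]; last by exists c, d, r.
by rewrite (smallest_same_column sm sm').
Qed.

Lemma not_enters_smallest y i j i' j' c d r :
  ~ enters y i j i' j' -> ~ enters y i' j' i j ->
  smallest y i j c d r -> smallest y i' j' c d r.
Proof.
move=> n1 n2 [sq b min].
have same c1 d1 r1 : square y c1 d1 r1 -> box c1 d1 r1 i j = box c1 d1 r1 i' j'.
  move=> sq1; apply/idP/idP => b1; apply: contrapT => /negP b2.
    by apply: n2; exists c1, d1, r1.
  by apply: n1; exists c1, d1, r1.
split => //; first by rewrite -same.
by move=> c' d' r' sq' b'; apply: (min _ _ _ sq'); rewrite same.
Qed.

Lemma not_enters_colour y i j i' j' p p' (s : bool) :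
  ~ enters y i j i' j' -> ~ enters y i' j' i j ->
  (forall c, odd (absz (i' - c)%R) = s (+) odd (absz (i - c)%R)) -> p' = s (+) p ->
  colour y i' j' p' = s (+) colour y i j p.
Proof.
move=> n1 n2 hs hp; have [cov|ncov] := pselect (covered y i j).
  have [c [d [r sm]]] := smallest_exists cov.
  by rewrite (colour_smallest _ sm) (colour_smallest _ (not_enters_smallest n1 n2 sm)).
rewrite /colour; case: pselect => [cov|ncov'] /=; last by case: pselect.
have [c [d [r sm]]] := smallest_exists cov.
by have [sq b _] := not_enters_smallest n2 n1 sm; case: ncov; exists c, d, r.
Qed.

(** The label of the cell [(i, j)] in the configuration [y]; [p] is the colour
    used for a cell that lies in no square. *)
Definition toast_label (y : int -> int -> bool) (i j : int) (p : bool) : cell_label :=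
  (`[< enters y i j (i + 1) j >], `[< enters y (i + 1) j i j >],
   `[< enters y i j i (j + 1) >], `[< enters y i (j + 1) i j >], colour y i j p).

Lemma patch_depth_rule (h0 h1 h2 g0 g1 g2 c c1 c2 : bool) :
  (h0 && h2 ==> h1) && (h1 ==> h0 || h2) ->
  depth_rule
    (~~ (h0 && g0) && (h1 && g0), ~~ (h1 && g0) && (h0 && g0),
     ~~ (h0 && g0) && (h0 && g1), ~~ (h0 && g1) && (h0 && g0), c)
    (~~ (h1 && g0) && (h2 && g0), ~~ (h2 && g0) && (h1 && g0),
     ~~ (h1 && g0) && (h1 && g1), ~~ (h1 && g1) && (h1 && g0), c1)
    (~~ (h0 && g1) && (h1 && g1), ~~ (h1 && g1) && (h0 && g1),
     ~~ (h0 && g1) && (h0 && g2), ~~ (h0 && g2) && (h0 && g1), c2).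
Proof. by case: h0; case: h1; case: h2 => //; case: g0; case: g1; case: g2. Qed.

Lemma toast_label_rule y i j p :
  rule (toast_label y i j p) (toast_label y (i + 1) j (~~ p))
       (toast_label y i (j + 1) p).
Proof.
have [hx [hy [conv wide en]]] := enters_patch y i j.
have e2 k : k + 1 + 1 = k + 2 :> int by lia.
apply/andP; split.
  have ij0 (k : int) : k <= k <= k + 2 by lia.
  have ij1 (k : int) : k <= k + 1 <= k + 2 by lia.
  have ij2 (k : int) : k <= k + 2 <= k + 2 by lia.
  rewrite /toast_label !e2 !en //; apply: patch_depth_rule.
  apply/andP; split; apply/implyP; last exact: wide.
  by move=> /andP[h0 h2]; exact: conv.
have none a b a' b' : (`[< enters y a b a' b' >]%:Z - `[< enters y a' b' a b >]%:Z == 0)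
    -> ~ (enters y a b a' b' /\ enters y a' b' a b) ->
    ~ enters y a b a' b' /\ ~ enters y a' b' a b.
  by case: asboolP => e1; case: asboolP => e2' // _ no; case: no.
have not2 a b a' b' : i <= a <= i + 2 -> i <= a' <= i + 2 -> j <= b <= j + 2 ->
    j <= b' <= j + 2 -> ~ (enters y a b a' b' /\ enters y a' b' a b).
  move=> ra ra' rb rb' [/asboolP + /asboolP]; rewrite !en //.
  by case: (hx a && hy b); case: (hx a' && hy b').
apply/andP; split; apply/implyP => /none[]; try by apply: not2; lia.
  move=> n1 n2; rewrite /toast_label /colour_bit.
  rewrite (@not_enters_colour y i j (i + 1) j p (~~ p) true) //; first by case: colour.
  by move=> c; lia.
move=> n1 n2; rewrite /toast_label /colour_bit.
by rewrite (@not_enters_colour y i j i (j + 1) p p false).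
Qed.

Section Translation.
Variables (y : int -> int -> bool) (u v : int).
Let yt (i j : int) := y (i + u) (j + v).

Lemma box_translate c d r i j : box (c + u) (d + v) r (i + u) (j + v) = box c d r i j.
Proof. by rewrite /box; lia. Qed.

Lemma square_translate c d r : square yt c d r <-> square y (c + u) (d + v) r.
Proof.
have bV e i j : box c d e (i - u) (j - v) = box (c + u) (d + v) e i j.
  by rewrite /box; lia.
split=> -[r0 sq]; split => // i j.
  by have := sq (i - u) (j - v); rewrite /yt !bV !subrK.
by have := sq (i + u) (j + v); rewrite !box_translate.
Qed.

Lemma square_translateV c d r : square y c d r -> square yt (c - u) (d - v) r.
Proof. by move=> sq; apply/square_translate; rewrite !subrK. Qed.

Lemma box_translateV c d r i j : box (c - u) (d - v) r i j = box c d r (i + u) (j + v).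
Proof. by rewrite -box_translate !subrK. Qed.

Lemma enters_translate i j i' j' :
  enters yt i j i' j' <-> enters y (i + u) (j + v) (i' + u) (j' + v).
Proof.
split=> -[c [d [r [sq out inn]]]].
  exists (c + u), (d + v), r; rewrite !box_translate; split => //.
  exact/square_translate.
exists (c - u), (d - v), r; rewrite !box_translateV; split => //.
exact: square_translateV.
Qed.

Lemma smallest_translate i j c d r :
  smallest yt i j c d r -> smallest y (i + u) (j + v) (c + u) (d + v) r.
Proof.
case=> sq b min; split; [exact/square_translate|by rewrite box_translate|].
move=> c' d' r' sq' b'; apply: (min _ _ _ (square_translateV sq')).
by rewrite box_translateV.
Qed.

Lemma colour_translate i j p : colour yt i j p = colour y (i + u) (j + v) p.
Proof.
have [cov|ncov] := pselect (covered yt i j).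
  have [c [d [r sm]]] := smallest_exists cov.
  rewrite (colour_smallest _ sm) (colour_smallest _ (smallest_translate sm)).
  by congr (odd (absz _)); lia.
rewrite /colour; case: pselect => [//|n1] /=; case: pselect => // -[c [d [r [sq b]]]].
case: ncov; exists (c - u), (d - v), r; rewrite box_translateV.
by split => //; exact: square_translateV.
Qed.

Lemma toast_label_translate i j p :
  toast_label yt i j p = toast_label y (i + u) (j + v) p.
Proof.
have en i1 j1 i2 j2 : `[< enters yt i1 j1 i2 j2 >] =
    `[< enters y (i1 + u) (j1 + v) (i2 + u) (j2 + v) >].
  by apply/asboolP/asboolP => /enters_translate.
by rewrite /toast_label !en colour_translate ![_ + 1 + _]addrAC.
Qed.

End Translation.

(** Inside a square, the label of a cell depends only on the bits in the outer
    box of that square: a square that separates two of its cells is nested in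
    it. *)
Section Locality.
Variables (y y' : int -> int -> bool) (c d : int) (r : nat).
Hypotheses (sq : square y c d r)
  (yy' : forall i j, box c d (3 * r + 2)%N i j -> y i j = y' i j).

Lemma square_local : square y' c d r.
Proof. by have [r0 s] := sq; split => // i j b nb; rewrite -yy' // s. Qed.

Lemma subsquare_local c1 d1 r1 i j : square y c1 d1 r1 -> (r1 <= r)%N ->
  box c1 d1 r1 i j -> box c d r i j -> square y' c1 d1 r1.
Proof.
move=> sq1 r1r b1 b; have [-> -> ->|n1 n2 n3 n4|far] := square_laminar sq sq1 r1r.
- exact: square_local.
- have [r0 s] := sq1; split => // k l bkl nb; rewrite -yy' ?s //.
  by move: bkl; rewrite /box; lia.
- by move: b1 b; rewrite /box; lia.
Qed.

Lemma enters_local i j i' j' : box c d r i j -> box c d r i' j' ->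
  enters y i j i' j' -> enters y' i j i' j'.
Proof.
move=> b b' [c1 [d1 [r1 [sq1 out inn]]]]; exists c1, d1, r1; split => //.
apply: (subsquare_local sq1 _ inn) => //; rewrite leqNgt; apply/negP => lt.
have [e1 e2 e3|n1 n2 n3 n4|far] := square_laminar sq1 sq (ltnW lt).
- by move: b out; rewrite e1 e2 e3 => ->.
- by move: b out; rewrite /box; lia.
- by move: b' inn; rewrite /box; lia.
Qed.

End Locality.

Lemma smallest_local y y' c d r c1 d1 r1 i j : square y c d r ->
  (forall i j, box c d (3 * r + 2)%N i j -> y i j = y' i j) -> box c d r i j ->
  smallest y i j c1 d1 r1 -> smallest y' i j c1 d1 r1.
Proof.
move=> sq yy' b [sq1 b1 min].
have r1r := min _ _ _ sq b.
have sq' := square_local sq yy'.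
split => //; first exact: (subsquare_local sq yy' sq1 r1r b1 b).
move=> c2 d2 r2 sq2 b2; have [le|lt] := leqP r2 r.
  apply: (min c2 d2 r2 _ b2); apply: (subsquare_local sq' _ sq2 le b2 b) => k l bkl.
  by rewrite yy'.
exact: leq_trans r1r (ltnW lt).
Qed.

Lemma toast_label_local y y' c d r i j p p' : square y c d r ->
  (forall i j, box c d (3 * r + 2)%N i j -> y i j = y' i j) ->
  box c d r i j -> box c d r (i + 1) j -> box c d r i (j + 1) ->
  toast_label y i j p = toast_label y' i j p'.
Proof.
move=> sq yy' b b1 b2; have sq' := square_local sq yy'.
have y'y i0 j0 (bb : box c d (3 * r + 2)%N i0 j0) : y' i0 j0 = y i0 j0 by rewrite yy'.
have en a a' e e' : box c d r a e -> box c d r a' e' ->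
    `[< enters y a e a' e' >] = `[< enters y' a e a' e' >].
  move=> ba ba'; apply/asboolP/asboolP; first exact: enters_local sq yy' _ _ _ _ ba ba'.
  exact: enters_local sq' y'y _ _ _ _ ba ba'.
rewrite /toast_label !en //; congr (_, _).
have cov : covered y i j by exists c, d, r.
have [c1 [d1 [r1 sm]]] := smallest_exists cov.
by rewrite (colour_smallest _ sm) (colour_smallest _ (smallest_local sq yy' b sm)).
Qed.

Local Open Scope classical_set_scope.
Local Open Scope ring_scope.

(** * Polish topologies given by countably many discrete coordinates *)

(** [x] and [y] have the same first [N] coordinates. *)
Definition agree (X T : Type) (h : nat -> X -> T) (N : nat) (x y : X) : Prop :=
  forall k, (k < N)%N -> h k x = h k y.

(** The maps [h k] embed [X] as a closed subspace of the sequences in the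
    discrete space [T]. *)
Definition coordinates (X : topologicalType) (T : Type) (h : nat -> X -> T) : Prop :=
  [/\ forall x A, nbhs x A <-> exists N, [set y | agree h N x y] `<=` A,
      forall x y, (forall k, h k x = h k y) -> x = y &
      forall u : nat -> X,
        (forall k, exists N, forall m, (N <= m)%N -> h k (u m) = h k (u N)) ->
        exists l, forall k, exists N, forall m, (N <= m)%N -> h k (u m) = h k l].

Section Agree.
Variables (X T : Type) (h : nat -> X -> T).

Lemma agreeS M N x y : (M <= N)%N -> agree h N x y -> agree h M x y.
Proof. by move=> MN a k kM; apply/a/(leq_trans kM). Qed.

Lemma agree_trans N x y z : agree h N x y -> agree h N y z -> agree h N x z.
Proof. by move=> a b k kN; rewrite a ?b. Qed.

End Agree.

Section Coordinates.
Variables (X : topologicalType) (T : countType) (h : nat -> X -> T).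
Hypothesis coord : coordinates h.

(** One point is chosen for each finite list of coordinates. *)
Lemma coord_separable : separable X.
Proof.
have [nb _ _] := coord.
have [[x0]|X0] := pselect (exists x : X, True); last first.
  by exists set0 => // U [x _]; case: X0; exists x.
pose q (s : seq T) : X := xget x0 [set x | [seq h k x | k <- iota 0 (size s)] = s].
exists (range q); first exact: sub_countable (card_image_le _ _) (countableP _).
move=> U [x Ux] oU.
have /nb[N NU] : nbhs x U by apply: open_nbhs_nbhs; split.
pose s := [seq h k x | k <- iota 0 N].
exists (q s); split; last by exists s.
have sz : size s = N by rewrite size_map size_iota.
have /xgetPex/= : exists y, [set y | [seq h k y | k <- iota 0 (size s)] = s] y.
  by exists x; rewrite /= sz.
move=> /(_ x0); rewrite -/(q s) sz => e; apply: NU => k kN /=.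
have := congr1 (fun s => nth (h k x) s k) e.
by rewrite /s !(nth_map 0%N) ?size_iota // !nth_iota.
Qed.

Section Metric.
Variable R : realType.

(** The ultrametric whose balls are the cylinders. *)
Definition coord_dist (x y : X) : R :=
  match pselect (exists k, h k x != h k y) with
  | left ex => (ex_minn ex).+1%:R^-1
  | right _ => 0
  end.

Lemma coord_distP (x y : X) :
  (x = y /\ coord_dist x y = 0) \/
  exists k, [/\ h k x != h k y, agree h k x y & coord_dist x y = k.+1%:R^-1].
Proof.
have [_ sep _] := coord; rewrite /coord_dist; case: pselect => [ex|no].
  right; case: ex_minnP => k kP min; exists k; split => // i ik.
  by apply/eqP; apply: contraTT ik => /min; rewrite -leqNgt.
left; split => //; apply: sep => k; apply: contrapT => /eqP ne.
by apply: no; exists k.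
Qed.

Lemma coord_dist_lt x y (N : nat) : coord_dist x y < N.+1%:R^-1 <-> agree h N.+1 x y.
Proof.
have [[-> ->]|[k [ne ag ->]]] := coord_distP x y.
  by split => // _; rewrite invr_gt0 ltr0n.
rewrite ltf_pV2 ?posrE ?ltr0n // ltr_nat ltnS; split=> [Nk|a].
  exact: agreeS ag.
by rewrite ltnNge; apply/negP => kN; move/eqP: ne; apply; apply: a.
Qed.

Lemma coord_dist_ge0 x y : 0 <= coord_dist x y.
Proof.
by have [[_ ->]|[k [_ _ ->]]] := coord_distP x y; rewrite ?invr_ge0 ?ler0n.
Qed.

Lemma coord_dist_metric : is_metric coord_dist.
Proof.
have z x : coord_dist x x = 0.
  by have [[_ ->]|[k [/eqP]]] := coord_distP x x.
split; first exact: coord_dist_ge0.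
- move=> x y; split=> [|->//].
  have [[-> //]|[k [_ _ ->]]] := coord_distP x y.
  by move/eqP; rewrite invr_eq0 pnatr_eq0.
- have le x y : coord_dist x y <= coord_dist y x.
    have [[-> _]|[k [ne ag e]]] := coord_distP y x; first by [].
    rewrite leNgt e; apply/negP => lt.
    have [[xy _]|[j [ne' ag' e']]] := coord_distP x y.
      by move: ne; rewrite xy eqxx.
    rewrite e' ltf_pV2 ?posrE ?ltr0n // ltr_nat ltnS in lt.
    by move/eqP: ne'; apply; rewrite ag.
  by move=> x y; apply/eqP; rewrite eq_le !le.
- move=> x y w.
  have [[-> ->]|[k [ne ag ->]]] := coord_distP x w.
    by rewrite addr_ge0 // coord_dist_ge0.
  rewrite leNgt; apply/negP => lt.
  have a1 : agree h k.+1 x y.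
    apply/coord_dist_lt/(le_lt_trans _ lt).
    by rewrite lerDl coord_dist_ge0.
  have a2 : agree h k.+1 y w.
    apply/coord_dist_lt/(le_lt_trans _ lt).
    by rewrite lerDr coord_dist_ge0.
  by move/eqP: ne; apply; exact: (agree_trans a1 a2).
Qed.

Lemma coord_polish : polish R X.
Proof.
have [nb _ cmp] := coord.
split; first exact: coord_separable.
exists coord_dist; split; first exact: coord_dist_metric.
  move=> x A; rewrite nb; split=> [[N NA]|[e e0 eA]].
    exists N.+1%:R^-1; first by rewrite invr_gt0 ltr0n.
    by move=> y /coord_dist_lt xy; apply/NA/agreeS/xy.
  exists (Num.truncn e^-1).+1 => y xy; apply: eA => /=.
  apply: (lt_trans (proj2 (coord_dist_lt x y _) xy)).
  rewrite -[ltRHS]invrK ltf_pV2 ?posrE ?ltr0n ?invr_gt0 //.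
  by rewrite truncnS_gt.
move=> u cu.
have [k|l lP] := cmp u.
  have [|N hN] := cu k.+1%:R^-1; first by rewrite invr_gt0 ltr0n.
  exists N => m Nm; have /coord_dist_lt := hN m N Nm (leqnn N).
  by apply.
exists l => A /nb[N NA].
have [M hM] : exists M, forall m, (M <= m)%N -> agree h N l (u m).
  elim: {NA}N => [|N [M hM]]; first by exists 0%N.
  have [M' hM'] := lP N; exists (maxn M M') => m.
  rewrite geq_max => /andP[/hM a /hM' e] k.
  by rewrite ltnS leq_eqVlt => /orP[/eqP ->//|/a].
by exists M => // m /= /hM; exact: NA.
Qed.

End Metric.

(** Nowhere density, in terms of cylinders. *)
Definition coord_nowhere_dense (A : set X) : Prop :=
  forall x N, exists y M, agree h N x y /\ forall z, agree h M y z -> ~ A z.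

Lemma nowhere_dense_coord A : nowhere_dense A -> coord_nowhere_dense A.
Proof.
have [nb _ _] := coord.
move=> nA x N; apply: contrapT => no.
have : interior (closure A) x; last by rewrite nA.
apply/nb; exists N => y xy B /nb[M MB]; apply: contrapT => AB.
apply: no; exists y, M; split => // z /MB Bz Az; apply: AB.
by exists z.
Qed.

(** The Baire category theorem, for countably many nowhere dense sets. *)
Lemma coord_baire (F : nat -> set X) (x0 : X) :
  (forall n, coord_nowhere_dense (F n)) -> exists x, forall n, ~ F n x.
Proof.
have [_ _ cmp] := coord.
move=> nd.
have step (p : nat * (X * nat)) : exists q : nat * (X * nat),
    [/\ q.1 = p.1.+1, agree h p.2.2 p.2.1 q.2.1, (p.2.2 < q.2.2)%N &
        forall z, agree h q.2.2 q.2.1 z -> ~ F p.1 z].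
  case: p => n [x N]; have [y [M [xy My]]] := nd n x N.
  exists (n.+1, (y, maxn M N.+1)); split => //=; first by rewrite leq_max ltnSn orbT.
  by move=> z yz; apply: My; apply: agreeS yz; rewrite leq_max leqnn.
have /choice[g gP] := step.
pose s n := iter n g (0%N, (x0, 0%N)).
have s1 n : (s n).1 = n.
  by elim: n => //= n IH; have [-> _ _ _] := gP (s n); rewrite IH.
have inc n : (n <= (s n).2.2)%N.
  elim: n => // n IH; rewrite /s iterS -/(s n).
  by have [_ _ + _] := gP (s n); exact: leq_ltn_trans.
have mono n m : (n <= m)%N -> agree h (s n).2.2 (s n).2.1 (s m).2.1 /\
    ((s n).2.2 <= (s m).2.2)%N.
  elim: m => [|m IH]; first by rewrite leqn0 => /eqP ->.
  rewrite leq_eqVlt => /orP[/eqP ->//|]; rewrite ltnS => /IH[a le].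
  rewrite /s !iterS -/(s n) -/(s m); have [_ b lt _] := gP (s m).
  split; last exact: leq_trans (ltnW lt).
  by apply: agree_trans a _; apply: agreeS b.
have [k|l lP] := cmp (fun n => (s n).2.1).
  exists k.+1 => m km; have [a _] := mono _ _ km.
  by apply/esym/a/inc.
exists l => n; have [_ _ _ av] := gP (s n); rewrite s1 in av; apply: av.
rewrite -/(iter n.+1 g _) -/(s n.+1) => k kn.
have [N hN] := lP k; rewrite -(hN (maxn N n.+1)) ?leq_maxl //.
by have [a _] := mono n.+1 (maxn N n.+1) (leq_maxr _ _); exact: a.
Qed.

End Coordinates.

(** * The free part of the shift *)

Section Ptws.
Variables (I : eqType) (D : discreteTopologicalType) (e : nat -> I).
Hypothesis e_surj : forall i, exists k, e k = i.

Lemma ptws_nbhs (x : {ptws I -> D}) (A : set {ptws I -> D}) :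
  nbhs x A <-> exists N, [set y : {ptws I -> D} | agree (fun k z => z (e k)) N x y] `<=` A.
Proof.
have nF := nbhs_filter x.
pose B N := [set y : {ptws I -> D} | agree (fun k z => z (e k)) N x y].
split=> [|[N NA]]; last first.
  suff : nbhs x (B N) by apply: filterS.
  elim: N {NA} => [|N IH]; first by apply: filterS filterT => y _ k.
  have nN : nbhs x [set y : {ptws I -> D} | x (e N) = y (e N)].
    have : nbhs x (proj (e N) @^-1` [set x (e N)]).
      by apply: (@proj_continuous I (fun=> D) (e N) x); exact: discrete_set1.
    by apply: filterS => y /= <-.
  apply: filterS2 IH nN => y b ey k /=.
  by rewrite ltnS leq_eqVlt => /orP[/eqP -> //|/b].
pose F := filter_from [set: nat] B.
have FF : Filter F.
  apply: filter_from_filter; first by exists 0%N.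
  move=> i j _ _; exists (maxn i j) => // y b; split; apply: agreeS b.
    exact: leq_maxl.
  exact: leq_maxr.
suff : F --> x by move=> /(_ A) + nA => /(_ nA)[N _ NA]; exists N.
apply/cvg_sup => i; apply/cvg_image.
  by rewrite eqEsubset; split=> v // _; exists (fun=> v).
move=> V; rewrite nbhs_principalE => /principal_filterP Vx.
have [k ek] := e_surj i.
exists [set y : {ptws I -> D} | V (y i)].
  by exists k.+1 => // y b /=; rewrite -ek -(b k (ltnSn k)) ek.
rewrite eqEsubset; split => [_ [y Vy <-] //|v Vv].
by exists (fun=> v).
Qed.

End Ptws.

Lemma set_val_nbhs (X : topologicalType) (A : set X) (x : A) (U : set A) :
  nbhs x U <-> exists2 V, nbhs (val x) V & val @^-1` V `<=` U.
Proof.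
split=> [|[V nV VU]].
  case=> _ [[W oW <-] Wx WU]; exists W => //; exact: open_nbhs_nbhs.
apply: filterS VU _; exact: (@initial_continuous A X val x V nV).
Qed.

Lemma continuous_borel_action (G : groupType) (X : topologicalType)
  (a : gaction G X) : (forall g, continuous (a g)) -> borel_action a.
Proof.
move=> ca g B oB.
suff : <<s @open X >> `<=` [set C | <<s @open X >> (a g @^-1` C)] by apply.
have [s0 sC sU] := @smallest_sigma_algebra X setT open.
apply: smallest_sub => [|U oU]; last first.
  by apply: sub_sigma_algebra; move/continuousP: (ca g); apply.
split=> [|C gC|F gF] /=.
- by rewrite preimage_set0.
- by rewrite setTD -preimage_setC -setTD; exact: sC.
- by rewrite preimage_bigcup; exact: sU.
Qed.

Lemma near_bounded (X : topologicalType) (x : X) (P : nat -> set X) N :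
  (forall k, (k < N)%N -> nbhs x (P k)) ->
  nbhs x [set y | forall k, (k < N)%N -> P k y].
Proof.
have nF := nbhs_filter x.
elim: N => [|N IH] nP; first by apply: filterS filterT => y _ k.
apply: filterS2 (IH _) (nP N (ltnSn N)) => [y b ey k /=|k kN].
  by rewrite ltnS leq_eqVlt => /orP[/eqP -> //|/b].
by apply: nP; rewrite ltnS ltnW.
Qed.

Section FreePartPolish.
Variables (G : groupType) (e : nat -> G).
Hypothesis e_surj : forall g, exists k, e k = g.

(** The index of a witness that [g] is not a period of [x]; it is [0] if [g] is
    a period. *)
Definition aperiodic_index (g : G) (x : G -> bool) : nat :=
  match pselect (exists i, x (e i * g)%g != x (e i)) with
  | left ex => ex_minn ex
  | right _ => 0%N
  end.

Lemma aperiodic_indexP (x : free_part G bool) g : g <> 1%g ->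
  let i := aperiodic_index g (val x) in val x (e i * g)%g != val x (e i) /\
    forall j, (j < i)%N -> val x (e j * g)%g = val x (e j).
Proof.
move=> g1; rewrite /aperiodic_index; case: pselect => [ex|no] /=.
  case: ex_minnP => m ne min; split => // j jm.
  by apply/eqP; apply: contraTT jm => /min; rewrite -leqNgt.
exfalso; apply: (set_mem (valP x) _ g1); apply/funext => d.
have [k <-] := e_surj d; apply: contrapT => /eqP ne.
by apply: no; exists k.
Qed.

(** The bits of a point, together with witnesses of its freeness. *)
Definition free_coord (k : nat) (x : free_part G bool) : bool * nat :=
  (val x (e k), aperiodic_index (e k) (val x)).

Lemma aperiodic_index_eq (x : G -> bool) g i : x (e i * g)%g != x (e i) ->
  (forall j, (j < i)%N -> x (e j * g)%g = x (e j)) -> aperiodic_index g x = i.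
Proof.
move=> ne eq; rewrite /aperiodic_index; case: pselect => [ex|[]]; last by exists i.
case: ex_minnP => m ne' min; apply/eqP; rewrite eqn_leq min //= leqNgt.
by apply/negP => /eq /eqP; exact/negP.
Qed.

Lemma free_part_near (x : free_part G bool) g : nbhs x [set y | val x g = val y g].
Proof.
apply/set_val_nbhs; exists [set y : {ptws G -> bool} | val x g = y g] => //.
apply/(ptws_nbhs e_surj); have [k <-] := e_surj g.
by exists k.+1 => y /(_ k (ltnSn k)).
Qed.

(** The coordinates are locally constant: the least witness of aperiodicity and
    its minimality involve finitely many bits. *)
Lemma free_coord_near k (x : free_part G bool) :
  nbhs x [set y | free_coord k x = free_coord k y].
Proof.
have nF := nbhs_filter x.
have [e1|/eqP ne1] := eqVneq (e k) 1%g.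
  apply: filterS (free_part_near x (e k)) => y /= xy.
  rewrite /free_coord; congr (_, _); first exact: xy.
  have z (w : G -> bool) : aperiodic_index (e k) w = 0%N.
    rewrite /aperiodic_index; case: pselect => // ex.
    by exfalso; move: ex => [i]; rewrite e1 mulg1 eqxx.
  by rewrite !z.
have [ne eq] := aperiodic_indexP x ne1.
set i := aperiodic_index _ _ in ne eq.
have nj : nbhs x [set y | forall j, (j < i.+1)%N ->
    ([set y | val x (e j) = val y (e j)] `&`
     [set y | val x (e j * e k)%g = val y (e j * e k)%g]) y].
  by apply: near_bounded => j _; apply: filterI; exact: free_part_near.
apply: filterS2 (free_part_near x (e k)) nj => y xy nj /=.
rewrite /free_coord; congr (_, _); first exact: xy.
apply/esym/aperiodic_index_eq => [|j ji].
  by have [/= <- <-] := nj i (ltnSn i).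
by have [/= <- <-] := nj j (ltnW ji); exact: eq.
Qed.

Lemma free_part_coordinates : coordinates free_coord.
Proof.
have nb (x : free_part G bool) A : nbhs x A ->
    exists N, [set y : free_part G bool |
      agree (fun k z => val z (e k)) N x y] `<=` A.
  move=> /set_val_nbhs[V /(ptws_nbhs e_surj)[N NV] VA].
  by exists N => y xy; apply: VA; exact: NV.
split.
- move=> x A; split=> [/nb[N NA]|[N NA]].
    by exists N => y xy; apply: NA => k kN; have [] := xy k kN.
  have nF := nbhs_filter x; apply: filterS NA _.
  by apply: near_bounded => k _; exact: free_coord_near.
- move=> x y xy; apply: val_inj; apply/funext => g; have [k <-] := e_surj g.
  by have [] := xy k.
move=> u hu.
have /choice[l lP] g : exists b, exists N, forall m, (N <= m)%N -> val (u m) g = b.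
  have [k <-] := e_surj g; have [N hN] := hu k; exists (val (u N) (e k)).
  by exists N => m /hN[].
have lF : free_part G bool l.
  move=> g g1 lg; have [k ek] := e_surj g; have [N hN] := hu k.
  have [i ei] : exists i, forall m, (N <= m)%N -> aperiodic_index g (val (u m)) = i.
    by exists (aperiodic_index g (val (u N))) => m /hN[_]; rewrite ek.
  have [N1 h1] := lP (e i); have [N2 h2] := lP (e i * g)%g.
  have [] := aperiodic_indexP (u (maxn N (maxn N1 N2))) g1.
  rewrite ei ?leq_maxl // h1 ?h2 ?leq_max ?leqnn ?orbT //.
  by rewrite -[in X in _ != X]lg /shift eqxx.
pose y : free_part G bool := exist _ l (mem_set lF).
exists y => k; have [N NA] := nb _ _ (free_coord_near k y).
have [M hM] : exists M, forall m, (M <= m)%N ->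
    agree (fun k (z : free_part G bool) => val z (e k)) N y (u m).
  elim: N {NA} => [|N [M hM]]; first by exists 0%N.
  have [M' hM'] := lP (e N); exists (maxn M M') => m.
  rewrite geq_max => /andP[/hM a /hM' eN] j.
  by rewrite ltnS leq_eqVlt => /orP[/eqP ->|/a]; rewrite ?eN.
by exists M => m /hM /NA.
Qed.

Lemma shift_free_continuous (g : G) : continuous (@shift_free G bool g).
Proof.
move=> x A /set_val_nbhs[V /(ptws_nbhs e_surj)[N NV] VA].
have nF := nbhs_filter x.
have nj : nbhs x [set y | forall j, (j < N)%N ->
    [set y | val x (e j * g)%g = val y (e j * g)%g] y].
  by apply: near_bounded => j _; exact: free_part_near.
by apply: filterS nj => y nj; apply: VA; apply: NV => j jN; exact: nj.
Qed.

Lemma shift_free_free : free_action (free_shift_action G bool).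
Proof. by move=> g x g1 /(congr1 val); exact: (set_mem (valP x) g g1). Qed.

Lemma BAIRE_sub_BaireSHIFT (R : realType) (P : LCL G) : BAIRE R P -> BaireSHIFT P.
Proof.
move=> B; apply: B.
- exact: (coord_polish free_part_coordinates R).
- exact: shift_free_free.
- by apply: continuous_borel_action => g; exact: shift_free_continuous.
Qed.

End FreePartPolish.

(** * The rectangle problem and the odometer action *)

Section ToastProblem.
Variables (n : nat) (hn : (2 <= n)%N).

Definition ord_e1 : 'I_n := Ordinal (ltnW hn).
Definition ord_e2 : 'I_n := Ordinal hn.

(** The elements of the plane spanned by the first two basis vectors. *)
Definition cell (i j : int) : 'rV[int]_n :=
  i *: delta_mx 0 ord_e1 + j *: delta_mx 0 ord_e2.

Lemma cell_coord i j (k : 'I_n) : cell i j 0 k =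
  if k == ord_e1 then i else if k == ord_e2 then j else 0.
Proof.
rewrite !mxE eqxx /=; have [->|ne1] := eqVneq k ord_e1.
  by rewrite /= mulr1 mulr0 addr0.
by case: eqVneq => _; rewrite ?mulr0 ?mulr1 ?add0r.
Qed.

Lemma cellD i j i' j' : cell (i + i') (j + j') = cell i j + cell i' j'.
Proof. by rewrite /cell !scalerDl addrACA. Qed.

Lemma cell00 : cell 0 0 = 0.
Proof. by rewrite /cell !scale0r addr0. Qed.

Lemma cellDr i j : cell (i + 1) j = cell 1 0 + cell i j.
Proof. by rewrite -cellD add0r addrC. Qed.

Lemma cellDu i j : cell i (j + 1) = cell 0 1 + cell i j.
Proof. by rewrite -cellD add0r addrC. Qed.

(** A cell, its right neighbour and its upper neighbour. *)
Definition toast_window : {fset Zpow n} :=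
  [fset (cell 0 0 : Zpow n); (cell 1 0 : Zpow n); (cell 0 1 : Zpow n)]%fset.

Lemma toast_window0 : (cell 0 0 : Zpow n) \in toast_window.
Proof. by rewrite !inE eqxx. Qed.
Lemma toast_window1 : (cell 1 0 : Zpow n) \in toast_window.
Proof. by rewrite !inE eqxx orbT. Qed.
Lemma toast_window2 : (cell 0 1 : Zpow n) \in toast_window.
Proof. by rewrite !inE eqxx orbT. Qed.

(** The rules of [rule], imposed in the plane of the first two basis vectors. *)
Definition toast_LCL : LCL (Zpow n) := @MkLCL (Zpow n) toast_window cell_label
  [set p | rule (p [` toast_window0]%fset) (p [` toast_window1]%fset)
                (p [` toast_window2]%fset)].

Lemma toast_solutionP (X : Type) (a : gaction (Zpow n) X) (f : X -> cell_label) :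
  is_solution (P := toast_LCL) a f <->
  forall x, rule (f x) (f (a (cell 1 0) x)) (f (a (cell 0 1) x)).
Proof.
have a1 x : a (cell 0 0) x = x by rewrite cell00; exact: gact1.
by split=> s x; have := s x; rewrite /is_solution /= a1.
Qed.

Lemma toast_valid (X : Type) (a : gaction (Zpow n) X) (f : X -> cell_label) x :
  is_solution (P := toast_LCL) a f -> valid (fun i j => f (a (cell i j) x)).
Proof.
move=> /toast_solutionP s i j.
have := s (a (cell i j) x).
by rewrite -!gactM cellDr cellDu.
Qed.

(** The moduli [m_k = 3 ^ (2 ^ k)], and the partial sums of the 3-adic unit
    [1 + m_0 + m_1 + ...], which is irrational because the moduli grow fast;
    the partial sum before [m_k] is its residue modulo [m_k]. *)
Definition modulus (k : nat) : nat := 3 ^ (2 ^ k).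

Fixpoint unit_residue (k : nat) : nat :=
  if k is k'.+1 then unit_residue k' + modulus k' else 1.

Lemma modulusS k : modulus k.+1 = (modulus k * modulus k)%N.
Proof. by rewrite /modulus expnS mulnC expnM expnS expn1. Qed.

Lemma modulus_ge3 k : (3 <= modulus k)%N.
Proof. by elim: k => // k IH; rewrite modulusS; nia. Qed.

Lemma odd_modulus k : odd (modulus k).
Proof. by rewrite oddX orbT. Qed.

Lemma modulus_gt k : (k < modulus k)%N.
Proof. by elim: k => // k IH; rewrite modulusS; have := modulus_ge3 k; nia. Qed.

Lemma unit_residue_bounds k :
  (k < unit_residue k)%N /\ (unit_residue k.+1 <= 2 * modulus k)%N.
Proof.
elim: k => // k [IH1 IH2]; have := modulus_ge3 k; have := modulusS k.
by rewrite /= in IH2 *; split; nia.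
Qed.

Lemma unit_residue_mod3 k : (unit_residue k %% 3 = 1)%N.
Proof.
elim: k => // k IH /=; rewrite -modnDm IH.
have /eqP -> // : (modulus k %% 3 == 0)%N by apply: dvdn_exp; rewrite ?expn_gt0.
Qed.

Lemma dvdn_modulus j k : (j <= k)%N -> (modulus j %| modulus k)%N.
Proof. by move=> jk; rewrite dvdn_exp2l // leq_exp2l. Qed.

Lemma unit_residue_compat j k : (j <= k)%N ->
  exists q, unit_residue k = (unit_residue j + q * modulus j)%N.
Proof.
elim: k => [|k IH]; first by rewrite leqn0 => /eqP ->; exists 0%N; rewrite addn0.
rewrite leq_eqVlt => /orP[/eqP ->|]; first by exists 0%N; rewrite addn0.
rewrite ltnS => jk; have [q e] := IH jk; have /dvdnP[r er] := dvdn_modulus jk.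
by exists (q + r)%N; rewrite /= e er mulnDl addnA.
Qed.

Lemma unit_residue_inv k : exists g : int,
  exists q : int, g * (unit_residue k)%:Z = 1 + q * (modulus k)%:Z.
Proof.
have : coprimez (unit_residue k) (modulus k).
  rewrite coprimezE /= coprimeXr // coprime_sym prime_coprime //.
  by rewrite /dvdn unit_residue_mod3.
case/coprimezP => -[u v] /= e; exists u, (- v).
by rewrite mulNr -[in RHS]e addrK.
Qed.

(** Rotation by [t] of each interval of integers between consecutive multiples
    of [m]; for [m = 0] it is the translation by [t]. *)
Definition turn (m : nat) (t y : int) : int :=
  (y %/ m%:Z)%Z * m%:Z + ((y + t) %% m%:Z)%Z.

Lemma turn_add m s t y : turn m s (turn m t y) = turn m (s + t) y.
Proof.
rewrite /turn; case: m => [|m].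
  by rewrite !modz0 !divz0 !mul0r !add0r -addrA [t + s]addrC.
have m0 : m.+1%:Z != 0 by [].
have small : (((y + t) %% m.+1%:Z)%Z %/ m.+1%:Z)%Z = 0.
  by apply: divz_small; rewrite modz_ge0 //= ltz_pmod.
rewrite divzMDl // small addr0.
congr (_ + _); rewrite -addrA modzMDl modzDml; congr (modz _ _); ring.
Qed.

Lemma turn0 m y : turn m 0 y = y.
Proof. by rewrite /turn addr0 -divz_eq. Qed.

Lemma turn_fixed m t y : turn m t y = y -> exists q : int, t = q * m%:Z.
Proof.
move=> e; have /eqP : ((y + t) %% m%:Z = y %% m%:Z)%Z.
  by apply: (addrI ((y %/ m%:Z)%Z * m%:Z)); rewrite -divz_eq.
rewrite -[y in X in (_ == X)]addr0 eqz_modDl mod0z => /eqP/dvdz_mod0P/dvdzP[q ->].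
by exists q.
Qed.

Lemma turn_congr m s t y (q : int) : s = t + q * m%:Z -> turn m s y = turn m t y.
Proof. by move=> ->; rewrite /turn [t + _]addrC (addrCA y) modzMDl. Qed.

(** The space of the action. Working with all sequences of integers, rather than
    with the 3-adic integers, avoids quotients: each coordinate is translated
    within blocks of length [odometer_modulus k]. *)
Definition odometer_space : topologicalType := {ptws nat -> discrete_topology int}.

(** The first [n] coordinates are there for freeness only: they are translated
    in the integers by the coordinates of the group element of index at least
    2. The others represent 3-adic residues, translated by 1 under the first
    basis vector and by [unit_residue] under the second one. *)
Definition odometer_modulus (k : nat) : nat :=
  if (k < n)%N then 0%N else modulus (k - n).

Definition odometer_step (g : 'rV[int]_n) (k : nat) : int :=
  if insub k is Some i then (if (2 <= k)%N then g 0 i else 0)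
  else g 0 ord_e1 + g 0 ord_e2 * (unit_residue (k - n))%:Z.

Definition odometer (g : 'rV[int]_n) (x : odometer_space) : odometer_space :=
  fun k => turn (odometer_modulus k) (odometer_step g k) (x k).

Lemma odometer_step0 k : odometer_step 0 k = 0.
Proof.
rewrite /odometer_step; case: insubP => [i _ _|_]; by rewrite !mxE ?if_same.
Qed.

Lemma odometer_stepD g h k :
  odometer_step (g + h) k = odometer_step g k + odometer_step h k.
Proof.
rewrite /odometer_step; case: insubP => [i _ _|_]; rewrite !mxE; last by ring.
by case: ifP => //; rewrite addr0.
Qed.

Lemma odometer1 x : odometer (1%g : Zpow n) x = x.
Proof. by apply/funext => k; rewrite /odometer odometer_step0 turn0. Qed.

Lemma odometerM (g h : Zpow n) x : odometer (g * h)%g x = odometer g (odometer h x).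
Proof. by apply/funext => k; rewrite /odometer odometer_stepD turn_add. Qed.

Definition odometer_action : gaction (Zpow n) odometer_space :=
  GAction odometer1 odometerM.

(** If [a + b * unit_residue k] vanishes modulo [modulus k] for all [k], then it is
    zero for large [k], so that [a = b = 0]. *)
Lemma odometer_free : free_action odometer_action.
Proof.
move=> g x g1 gx; apply: g1.
have fx k : exists q : int, odometer_step g k = q * (odometer_modulus k)%:Z.
  by apply: (@turn_fixed _ _ (x k)); rewrite -[in RHS]gx.
have big (i : 'I_n) : (2 <= i)%N -> g 0 i = 0.
  move=> i2; have [q] := fx i; rewrite /odometer_modulus ltn_ord mulr0.
  by rewrite /odometer_step valK i2.
pose a := g 0 ord_e1; pose b := g 0 ord_e2.
have ab k : exists q : int, a + b * (unit_residue k)%:Z = q * (modulus k)%:Z.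
  have [q] := fx (n + k)%N; rewrite /odometer_modulus ltnNge leq_addr /=.
  rewrite /odometer_step insubF ?ltnNge ?leq_addr // addKn => e.
  by exists q.
(* for large k the modulus exceeds the number it divides *)
have ab0 k : (absz a + 2 * absz b <= k)%N ->
    a + b * (unit_residue k.+1)%:Z = 0.
  move=> abk; have [q e] := ab k.+1.
  have [_ up] := unit_residue_bounds k; have gt := modulus_gt k.
  rewrite e; have [->|q0] := eqVneq q 0; first by rewrite mul0r.
  exfalso; rewrite modulusS in e.
  have le1 : (absz (a + b * (unit_residue k.+1)%:Z)%R < modulus k * modulus k)%N.
    have tri (p : int) : (absz (a + p)%R <= absz a + absz p)%N by clear; lia.
    apply: leq_ltn_trans (tri _) _; rewrite abszM absz_nat.
    move: up gt abk; clear; move: (absz a) (absz b) (unit_residue _) (modulus k).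
    by move=> x y U M up gt abk; nia.
  rewrite e abszM in le1; have : (0 < absz q)%N by rewrite absz_gt0.
  move: le1; rewrite absz_nat; clear.
  by move: (absz q) (modulus k) => x M; nia.
have b0 : b = 0.
  pose k := (absz a + 2 * absz b)%N.
  have := ab0 k (leqnn _); have := ab0 k.+1 (leqnSn _).
  have [lt _] := unit_residue_bounds k.+1.
  have := modulus_ge3 k.+1.
  by rewrite [unit_residue k.+2]/= PoszD; nia.
have a0 : a = 0.
  by have := ab0 _ (leqnn _); rewrite b0 mul0r addr0.
apply/rowP => i; rewrite mxE.
have [i2|] := leqP 2 i; first exact: big.
rewrite ltnS leq_eqVlt ltnS leqn0 => /orP[/eqP i1|/eqP i0].
  by rewrite (_ : i = ord_e2) //; exact: val_inj.
by rewrite (_ : i = ord_e1) //; exact: val_inj.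
Qed.

Lemma odometer_coordinates :
  coordinates (fun k (x : odometer_space) => (x k : int)).
Proof.
split.
- by move=> x A; apply: (ptws_nbhs (e := id)) => i; exists i.
- by move=> x y xy; apply/funext.
move=> u /choice[N hN]; exists (fun k => u (N k) k) => k.
by exists (N k) => m /hN.
Qed.

Lemma odometer_continuous g : continuous (odometer_action g).
Proof.
have [nb _ _] := odometer_coordinates.
move=> x A /nb[N NA]; apply/nb; exists N => y xy; apply: NA => k kN /=.
by rewrite /odometer (xy k kN).
Qed.

Lemma odometer_agree_iso K (g : Zpow n) x y :
  agree (fun k (z : odometer_space) => (z k : int)) K x y ->
  agree (fun k (z : odometer_space) => (z k : int)) K
    (odometer_action g x) (odometer_action g y).
Proof. by move=> xy k kK; rewrite /= /odometer (xy k kK). Qed.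

Lemma odometer_nowhere_dense (g : Zpow n) (A : set odometer_space) :
  coord_nowhere_dense (fun k (z : odometer_space) => (z k : int)) A ->
  coord_nowhere_dense (fun k (z : odometer_space) => (z k : int))
    (odometer_action g @^-1` A).
Proof.
move=> nA x N; have [y [M [xy My]]] := nA (odometer_action g x) N.
have K z : odometer_action g^-1%g (odometer_action g z) = z.
  by rewrite -gactM mulVg gact1.
exists (odometer_action g^-1%g y), M; split.
  by rewrite -[x]K; exact: odometer_agree_iso.
move=> z /(odometer_agree_iso g).
by rewrite -gactM mulgV gact1; exact: My.
Qed.

(** Two points of a planar orbit are close as soon as their linear forms
    [i + j * unit_residue K] are congruent modulo [modulus K]. *)
Lemma odometer_agree K z (i j i' j' q : int) :
  i' + j' * (unit_residue K)%:Z = i + j * (unit_residue K)%:Z + q * (modulus K)%:Z ->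
  agree (fun k (z : odometer_space) => (z k : int)) K
    (odometer_action (cell i j) z) (odometer_action (cell i' j') z).
Proof.
move=> e k kK; rewrite /= /odometer /odometer_modulus /odometer_step !cell_coord.
rewrite /=; case: insubP => [u _ uk|]; last rewrite -leqNgt => nk.
  rewrite -uk ltn_ord; case: ifP => // u2; rewrite !cell_coord.
  have [e1 e2] : u != ord_e1 /\ u != ord_e2.
    by split; apply/eqP => eu; move: u2; rewrite eu.
  by rewrite (negPf e1) (negPf e2).
rewrite ltnNge nk /=.
have [d ed] : exists d, (k - n + d = K)%N by exists (K - (k - n))%N; lia.
have [r er] := unit_residue_compat (leq_addr d (k - n)).
have /dvdnP[c ec] := dvdn_modulus (leq_addr d (k - n)).
rewrite ed in er ec.
apply/esym; apply: (@turn_congr _ _ _ _ (j * r%:Z - j' * r%:Z + q * c%:Z)).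
move: e; rewrite er ec !PoszD !PoszM => e.
by rewrite !mulrDl; move: e; rewrite !mulrDr; lia.
Qed.

(** A Baire-measurable solution coincides with a locally constant one along the
    orbit of a generic point [z]; as the action preserves agreement of
    coordinates, the labelling of the planar orbit of [z] is recurrent. *)
Lemma odometer_no_baire_solution :
  ~ has_baire_solution toast_LCL odometer_action.
Proof.
case=> f [bf sf].
pose h k (z : odometer_space) := (z k : int).
have /choice[U UP] (l : cell_label) : exists U : set odometer_space, open U /\
    exists F : (set odometer_space)^nat, (forall m, nowhere_dense (F m)) /\
      (f @^-1` [set l]) `+` U = \bigcup_m F m.
  have [U oU [F nF e]] := bf [set l] (discrete_open _).
  by exists U; split => //; exists F.
have /choice[F FP] l := proj2 (UP l).
pose Phi (m : nat) : set odometer_space :=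
  if @choice.unpickle ('rV[int]_n * (cell_label * nat))%type m is Some (g, (l, k))
  then odometer_action g @^-1` F l k else set0.
have [|z zP] := @coord_baire _ _ h odometer_coordinates Phi (fun=> 0).
  move=> m; rewrite /Phi; case: choice.unpickle => [[g [l k]]|].
    apply: odometer_nowhere_dense; have [nF _] := FP l.
    exact: (nowhere_dense_coord odometer_coordinates (nF k)).
  by move=> x N; exists x, N; split => // z _ [].
have generic (g : 'rV[int]_n) l :
    f (odometer_action g z) = l <-> U l (odometer_action g z).
  have no : ~ ((f @^-1` [set l]) `+` U l) (odometer_action g z).
    have [_ ->] := FP l => -[k _ Fk].
    by apply: (zP (choice.pickle (g, (l, k)))); rewrite /Phi choice.pickleK.
  by split=> [fl|Ul]; apply: contrapT => nU; apply: no; [left|right].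
pose c i j : cell_label := f (odometer_action (cell i j) z).
have vc : valid c by exact: toast_valid.
apply: (no_recurrent_valid vc) => i j M.
have /choice[K KP] (u : nat) : exists K, forall i' j',
    agree h K (odometer_action (cell (i + u%:Z) j) z)
              (odometer_action (cell i' j') z) ->
    c i' j' = c (i + u%:Z) j.
  set l := c (i + u%:Z) j.
  have [oU _] := UP l; have [nb _ _] := odometer_coordinates.
  have /nb[K KU] : nbhs (odometer_action (cell (i + u%:Z) j) z) (U l).
    by apply: open_nbhs_nbhs; split => //; apply/generic.
  by exists K => i' j' a; apply/generic/KU.
pose K0 := \max_(u < M.+1) K u.
have KM u : (u <= M)%N -> (K u <= K0)%N.
  by rewrite -ltnS => uM; rewrite (leq_bigmax (Ordinal uM)).
have near (u : nat) i' j' (q : int) : (u <= M)%N ->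
    i' + j' * (unit_residue K0)%:Z =
      i + u%:Z + j * (unit_residue K0)%:Z + q * (modulus K0)%:Z ->
    c i' j' = c (i + u%:Z) j.
  move=> uM e; apply: KP; apply: (agreeS (KM u uM)).
  exact: odometer_agree e.
have m0 : (modulus K0)%:Z != 0 :> int by have := modulus_ge3 K0; lia.
have rem (t : int) : exists2 a : nat, (a < modulus K0)%N &
    exists q : int, a%:Z = t + q * (modulus K0)%:Z.
  exists (absz (t %% (modulus K0)%:Z)%Z).
    by rewrite -ltz_nat gez0_abs ?modz_ge0 // ltz_pmod //; have := modulus_ge3 K0; lia.
  exists (- (t %/ (modulus K0)%:Z)%Z); rewrite gez0_abs ?modz_ge0 //.
  rewrite mulNr; move: (divz_eq t (modulus K0)%:Z); clear.
  by move: (modulus K0)%:Z (t %/ _)%Z (t %% _)%Z => m a b ->; ring.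
exists (modulus K0); split; first exact: odd_modulus.
- move=> i' j'.
  have [a aN [q e]] := rem (i + j * (unit_residue K0)%:Z - i' - j' * (unit_residue K0)%:Z).
  exists a => //; rewrite (near 0%N _ _ q) ?addr0 // e; ring.
- (* vertical recurrence uses the inverse of the 3-adic unit *)
  move=> i' j'; have [g [p eg]] := unit_residue_inv K0.
  set T := i + j * (unit_residue K0)%:Z - i' - j' * (unit_residue K0)%:Z.
  have [a aN [q e]] := rem (g * T).
  exists a => //; rewrite (near 0%N _ _ (T * p + q * (unit_residue K0)%:Z)) ?addr0 //.
  rewrite e; have -> : i' + (j' + (g * T + q * (modulus K0)%:Z)) * (unit_residue K0)%:Z
    = i' + j' * (unit_residue K0)%:Z + T * (g * (unit_residue K0)%:Z)
      + q * (unit_residue K0)%:Z * (modulus K0)%:Z by ring.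
  by rewrite eg /T; ring.
- by move=> u uM; apply: (near u _ _ 1) => //; ring.
Qed.

Lemma toast_not_BAIRE (R : realType) : ~ BAIRE R toast_LCL.
Proof.
move=> B; apply: odometer_no_baire_solution; apply: B.
- exact: (coord_polish odometer_coordinates R).
- exact: odometer_free.
- by apply: continuous_borel_action => g; exact: odometer_continuous.
Qed.

End ToastProblem.

(** * Solving the rectangle problem on the shift *)

(** Choosing a point in each orbit identifies the orbits of a free action with
    the group. *)
Lemma free_orbit_coordinate (G : groupType) (X : choiceType) (a : gaction G X) :
  free_action a -> exists rho : X -> G, forall g x, rho (a g x) = (g * rho x)%g.
Proof.
move=> fa; pose O x := [set y | exists g, y = a g x].
have OE g x : O (a g x) = O x.
  apply/seteqP; split=> y [h ->].
    by exists (h * g)%g; rewrite gactM.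
  by exists (h * g^-1)%g; rewrite -gactM -mulgA mulVg mulg1.
have xgetE (A : set X) x0 x1 : A !=set0 -> xget x0 A = xget x1 A.
  by move=> [y Ay]; rewrite /xget; case: pselect => // -[]; exists y; apply/asboolP.
pose rep x := xget x (O x).
have repE g x : rep (a g x) = rep x.
  by rewrite /rep OE; apply: xgetE; exists x, 1%g; rewrite gact1.
have /choice[h hP] x : exists h : G, x = a h (rep x).
  have [|h e] := @xgetPex _ x (O x); first by exists x, 1%g; rewrite gact1.
  by exists h^-1%g; rewrite /rep e -gactM mulVg gact1.
exists h => g x; apply: contrapT => ne.
apply: (fa ((g * h x)^-1 * h (a g x))%g (rep x)).
  by move=> /(congr1 (fun u => (g * h x) * u)%g); rewrite mulgA mulgV mul1g mulg1.
have e : a (h (a g x)) (rep x) = a (g * h x)%g (rep x).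
  by rewrite -{1}(repE g x) -hP gactM -hP.
by rewrite gactM e -gactM mulVg gact1.
Qed.

Section ShiftSolution.
Variables (n : nat) (hn : (2 <= n)%N).

(** An enumeration of the group. *)
Definition group_enum (k : nat) : Zpow n := odflt 0 (@choice.unpickle 'rV[int]_n k).

Lemma group_enum_surj (g : Zpow n) : exists k, group_enum k = g.
Proof. by exists (@choice.pickle 'rV[int]_n g); rewrite /group_enum choice.pickleK. Qed.

(** The restriction of a point of the shift to the plane of the cells. *)
Definition plane (x : free_part (Zpow n) bool) (i j : int) : bool :=
  val x (cell hn i j).

Lemma plane_shift i j x a b :
  plane (free_shift_action (Zpow n) bool (cell hn i j) x) a b = plane x (a + i) (b + j).
Proof. by rewrite /plane /= /shift cellD. Qed.

(** The colour of the points that lie in no square: the parity of the column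
    relative to the orbit representative. *)
Definition parity (rho : free_part (Zpow n) bool -> Zpow n) x : bool :=
  odd (absz ((rho x : 'rV[int]_n) ord0 (ord_e1 hn))).

(** The solution on the shift. *)
Definition toast_map (rho : free_part (Zpow n) bool -> Zpow n)
    (x : free_part (Zpow n) bool) : cell_label :=
  toast_label (plane x) 0 0 (parity rho x).

(** The points for which the cells of the window lie in a common square. *)
Definition well_covered : set (free_part (Zpow n) bool) :=
  [set x | exists c d r, [/\ square (plane x) c d r, box c d r 0 0,
                            box c d r 1 0 & box c d r 0 1]].

Lemma box_near (x : free_part (Zpow n) bool) c d r :
  nbhs x [set x' | forall i j, box c d r i j -> plane x i j = plane x' i j].
Proof.
have nF := nbhs_filter x.
have : nbhs x [set x' | forall a, (a < 2 * r + 1)%N ->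
    [set x' | forall b, (b < 2 * r + 1)%N ->
      [set x' | plane x (c - r%:Z + a%:Z) (d - r%:Z + b%:Z) =
                plane x' (c - r%:Z + a%:Z) (d - r%:Z + b%:Z)] x'] x'].
  apply: near_bounded => a _; apply: near_bounded => b _.
  exact: (free_part_near group_enum_surj).
apply: filterS => x' near i j bij.
have [a ea] : exists a : nat, i = c - r%:Z + a%:Z.
  by exists (absz (i - (c - r%:Z))%R); move: bij; rewrite /box; lia.
have [b eb] : exists b : nat, j = d - r%:Z + b%:Z.
  by exists (absz (j - (d - r%:Z))%R); move: bij; rewrite /box; lia.
move: bij; rewrite ea eb => bij; apply: near; move: bij; rewrite /box; lia.
Qed.

Lemma well_covered_local rho x : well_covered x ->
  nbhs x [set x' | well_covered x' /\ toast_map rho x' = toast_map rho x].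
Proof.
have nF := nbhs_filter x.
move=> [c [d [r [sq b0 b1 b2]]]].
apply: filterS (box_near x c d (3 * r + 2)) => x' /= near; split.
  by exists c, d, r; split => //; exact: square_local sq near.
by apply/esym; apply: toast_label_local sq near b0 b1 b2.
Qed.

Lemma well_covered_open : open well_covered.
Proof.
rewrite openE => x wx; have nF := nbhs_filter x.
by apply: filterS (well_covered_local (fun=> 1%g) wx) => x' [].
Qed.

(** A finite pattern is extended by a square that encloses it and by zeros
    elsewhere; the result has a finite nonempty support, hence no period. *)
Lemma well_covered_dense (x : free_part (Zpow n) bool)
    (A : set (free_part (Zpow n) bool)) :
  nbhs x A -> exists2 x', A x' & well_covered x'.
Proof.
move=> /set_val_nbhs[V /(ptws_nbhs group_enum_surj)[N NV] VA].
pose r := (\max_(k < N) \max_(i < n) absz ((group_enum k : 'rV[int]_n) ord0 i)).+1.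
have rP k i : (k < N)%N -> (absz ((group_enum k : 'rV[int]_n) ord0 i) < r)%N.
  move=> kN; rewrite ltnS.
  apply: leq_trans (leq_bigmax (Ordinal kN)).
  exact: (leq_bigmax (F := fun i => absz ((group_enum k : 'rV[int]_n) ord0 i)) i).
pose w (g : Zpow n) : bool := if pselect (exists2 k, (k < N)%N & group_enum k = g)
  then val x g else `[< exists i j, g = cell hn i j /\ box 0 0 r i j >].
have supp g i : w g -> (absz ((g : 'rV[int]_n) ord0 i) <= r)%N.
  rewrite /w; case: pselect => [old|new] /=.
    by move=> _; case: old => k kN <-; exact/ltnW/rP.
  move=> /asboolP[a [b [-> bab]]]; rewrite cell_coord.
  by move: bab; rewrite /box; case: ifP => _; [|case: ifP => _]; lia.
have wcell i j : ~~ box 0 0 r.-1 i j -> w (cell hn i j) = box 0 0 r i j.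
  move=> nb; rewrite /w; case: pselect => [[k kN ek]|new] /=.
    have := rP k (ord_e1 hn) kN; have := rP k (ord_e2 hn) kN.
    by rewrite ek !cell_coord eqxx /=; move: nb; rewrite /box; lia.
  apply/asboolP/idP => [[a [b [e bab]]]|bij]; last by exists i, j.
  have := congr1 (fun g : 'rV[int]_n => g 0 (ord_e1 hn)) e.
  have := congr1 (fun g : 'rV[int]_n => g 0 (ord_e2 hn)) e.
  by rewrite !cell_coord eqxx /= => -> ->.
have wF : free_part (Zpow n) bool w.
  move=> g g1 wg.
  have [i gi] : exists i, (g : 'rV[int]_n) ord0 i != 0.
    apply: contrapT => no; apply: g1; apply/rowP => i; rewrite mxE.
    by apply: contrapT => /eqP gi; apply: no; exists i.
  have iterw m : w (cell hn r%:Z 0 + (g : 'rV[int]_n) *+ m).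
    elim: m => [|m IH]; first by rewrite mulr0n addr0 wcell /box; lia.
    by rewrite mulrSr addrA; rewrite -wg in IH.
  have key m : (absz (cell hn r%:Z 0 ord0 i + (g : 'rV[int]_n) ord0 i *+ m)%R <= r)%N.
    by have := supp _ i (iterw m); rewrite mxE mulmxnE.
  move: (key 0%N) (key (2 * r + 1)%N) gi; rewrite mulr0n addr0 -mulr_natr.
  clear; move: (cell _ _ _ _ _) ((g : 'rV[int]_n) ord0 i) => u p; nia.
exists (exist _ (w : {ptws Zpow n -> bool}) (mem_set wF)).
  apply: VA; apply: NV => k kN /=.
  by rewrite /w; case: pselect => // new; case: new; exists k.
exists 0, 0, r; split; try (rewrite /box /r; lia).
by split=> // i j _; exact: wcell.
Qed.

Lemma toast_map_solution rho :
  (forall g x, rho (free_shift_action (Zpow n) bool g x) = (g * rho x)%g) ->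
  is_solution (P := toast_LCL hn) (free_shift_action (Zpow n) bool) (toast_map rho).
Proof.
move=> rhoE; apply/toast_solutionP => x.
have sh i j p : toast_label (plane (free_shift_action (Zpow n) bool (cell hn i j) x)) 0 0 p
    = toast_label (plane x) i j p.
  rewrite (_ : plane _ = fun a b => plane x (a + i) (b + j)).
    by rewrite toast_label_translate !add0r.
  by apply/funext => a; apply/funext => b; exact: plane_shift.
have rhoE' i j : (rho (free_shift_action (Zpow n) bool (cell hn i j) x) : 'rV[int]_n)
    ord0 (ord_e1 hn) = i + (rho x : 'rV[int]_n) ord0 (ord_e1 hn).
  rewrite rhoE -[(_ * _)%g]/(cell hn i j + (rho x : 'rV[int]_n)).
  by rewrite mxE cell_coord eqxx.
rewrite /toast_map !sh.
have -> : parity rho (free_shift_action (Zpow n) bool (cell hn 1 0) x) = ~~ parity rho x.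
  by rewrite /parity rhoE'; lia.
have -> : parity rho (free_shift_action (Zpow n) bool (cell hn 0 1) x) = parity rho x.
  by rewrite /parity rhoE' add0r.
exact: toast_label_rule.
Qed.

(** The map is locally constant on a dense open set, so that a preimage differs
    from its interior by a nowhere dense set. *)
Lemma toast_map_baire rho :
  baire_measurable (toast_map rho : _ -> discrete_topology cell_label).
Proof.
move=> V _; set A := toast_map rho @^-1` V.
exists (interior A); first exact: open_interior.
have sub : A `+` interior A `<=` ~` well_covered.
  move=> x [[Ax nx]|[ix nAx]] wx; last by apply: nAx; exact: interior_subset.
  apply: nx; have nF := nbhs_filter x.
  by apply: filterS (well_covered_local rho wx) => x' [_]; rewrite /A /= => ->.
exists (fun=> A `+` interior A); last by rewrite bigcup_const.
move=> _; apply/seteqP; split => // x nx; have [x' cx' wx'] := well_covered_dense nx.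
suff : closure (~` well_covered) x'.
  by rewrite -(closure_id _).1 //; exact: open_closedC well_covered_open.
exact: closure_subset sub _ cx'.
Qed.

Lemma toast_BaireSHIFT : BaireSHIFT (toast_LCL hn).
Proof.
have [rho rhoE] := free_orbit_coordinate (@shift_free_free (Zpow n)).
exists (toast_map rho); split; first exact: toast_map_baire.
exact: toast_map_solution.
Qed.

End ShiftSolution.

Theorem theorem1p14 (R : realType) (n : nat) (hn : (2 <= n)%N) :
  (forall P : LCL (Zpow n), BAIRE R P -> BaireSHIFT P) /\
  (exists P : LCL (Zpow n), BaireSHIFT P /\ ~ BAIRE R P).
Proof.
split=> [P|]; first exact: (BAIRE_sub_BaireSHIFT (@group_enum_surj n)).
by exists (toast_LCL hn); split; [exact: toast_BaireSHIFT|exact: toast_not_BAIRE].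
Qed.
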